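(* A compactly generated TDLC-group $G$ is hyperbolic if and only if $G$ is compactly presented and satisfies the weak linear isoperimetric inequality.
   Context: A TDLC-group is a totally disconnected locally compact Hausdorff topological group. A Cayley–Abels graph of a compactly generated TDLC-group $G$ is a connected locally finite graph on which $G$ acts vertex-transitively with compact open vertex stabilizers; $G$ is hyperbolic if it is compactly generated and some (equivalently every) Cayley–Abels graph is Gromov hyperbolic. $G$ is compactly presented if it admits a presentation $\langle K\mid R\rangle$ with $K$ compact and a uniform bound on the lengths of relators in $R$. For a TDLC-group $G$: a discrete $\mathbb{Q}[G]$-module is a left $\mathbb{Q}[G]$-module in which every element has open stabilizer (category ${}_{\mathbb{Q}[G]}\mathrm{dis}$). A $G$-set $\Omega$ is proper if all point stabilizers are compact open; $\mathbb{Q}[\Omega]$ is then a proper permutation module, finitely generated iff $\Omega/G$ is finite, with $\ell_1$-norm $\|\sum a_\omega\omega\|_1=\sum|a_\omega|$. $G$ has type $\mathrm{FP}_n$ if there is an exact sequence $\mathbb{Q}[\Omega_n]\to\cdots\to\mathbb{Q}[\Omega_0]\to\mathbb{Q}\to0$ in ${}_{\mathbb{Q}[G]}\mathrm{dis}$ with each $\Omega_i$ a proper $G$-set with finitely many orbits (a partial proper permutation resolution of finite type); compactly presented groups have type $\mathrm{FP}_2$. $G$ of type $\mathrm{FP}_{n+1}$ satisfies the weak $n$-dimensional linear isoperimetric inequality if for some (equivalently any) such resolution $\mathbb{Q}[\Omega_{n+1}]\xrightarrow{\delta_{n+1}}\mathbb{Q}[\Omega_n]\xrightarrow{\delta_n}\cdots\to\mathbb{Q}[\Omega_0]\to\mathbb{Q}\to0$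 there is $C>0$ with $\inf\{\|y\|_1: y\in\mathbb{Q}[\Omega_{n+1}],\ \delta_{n+1}(y)=x\}\le C\|x\|_1$ for all $x\in\ker\delta_n$. The case $n=1$ is called the weak linear isoperimetric inequality. *)

(* Defs.v *)
From HB Require Import structures.
From mathcomp Require Import all_boot all_order all_algebra.
From mathcomp Require Import all_classical all_reals all_analysis.
From Stdlib Require Import Relation_Operators.
Set Implicit Arguments. Unset Strict Implicit. Unset Printing Implicit Defensive.
Import Order.TTheory GRing.Theory Num.Theory.
Local Open Scope classical_set_scope.
Local Open Scope ring_scope.

Section TDLC.
Variables (T : topologicalType) (mul : T -> T -> T) (inv : T -> T) (one : T).

Definition is_tdlc_group : Prop :=
  (forall x y z, mul x (mul y z) = mul (mul x y) z) /\
  (forall x, mul one x = x) /\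
  (forall x, mul (inv x) x = one) /\
  continuous (fun p : T * T => mul p.1 p.2) /\ continuous inv /\
  hausdorff_space T /\
  totally_disconnected [set: T] /\
  locally_compact [set: T].

Definition letter_val (l : bool * T) : T := if l.1 then inv l.2 else l.2.
Definition eval_word (w : seq (bool * T)) : T :=
  foldr (fun l acc => mul (letter_val l) acc) one w.
Definition word_over (K : set T) (w : seq (bool * T)) : Prop :=
  forall l, l \in w -> K l.2.
Definition generates (K : set T) : Prop :=
  forall g, exists w, word_over K w /\ eval_word w = g.

Definition compactly_generated : Prop :=
  exists K : set T, compact K /\ generates K.

(** One elementary step in the free group on K modulo the normal closure of
    the relators R: deleting a cancelling pair of letters of K, or deleting a
    relator.  Its reflexive-symmetric-transitive closure, on words over K,
    is equality in the group <K | R>. *)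
Definition pres_step (K : set T) (R : set (seq (bool * T)))
    (w w' : seq (bool * T)) : Prop :=
  (exists u v (l : bool * T), K l.2 /\
      w = u ++ [:: l; (~~ l.1, l.2)] ++ v /\ w' = u ++ v) \/
  (exists u v r, R r /\ w = u ++ r ++ v /\ w' = u ++ v).

Definition compactly_presented : Prop :=
  exists (K : set T) (R : set (seq (bool * T))) (N : nat),
    compact K /\ generates K /\
    (forall r, R r -> word_over K r /\ eval_word r = one /\ (size r <= N)%N) /\
    (forall w, word_over K w -> eval_word w = one ->
       clos_refl_sym_trans _ (pres_step K R) w [::]).

Definition is_action (V : Type) (act : T -> V -> V) : Prop :=
  (forall v, act one v = v) /\ (forall g h v, act (mul g h) v = act g (act h v)).

Definition stab (V : Type) (act : T -> V -> V) (v : V) : set T :=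
  [set g | act g v = v].

Definition walk (V : Type) (adj : V -> V -> Prop) (u v : V) (n : nat) : Prop :=
  exists f : nat -> V,
    f 0%N = u /\ f n = v /\ forall i, (i < n)%N -> adj (f i) (f i.+1).

Definition graph_dist (V : Type) (adj : V -> V -> Prop) (u v : V) (n : nat) : Prop :=
  walk adj u v n /\ forall m, walk adj u v m -> (n <= m)%N.

Definition cayley_abels_graph (V : Type) (adj : V -> V -> Prop)
    (act : T -> V -> V) : Prop :=
  (exists v0 : V, True) /\
  (forall u v, adj u v -> adj v u) /\ (forall v, ~ adj v v) /\
  (forall v, finite_set [set u | adj v u]) /\
  (forall u v, exists n, walk adj u v n) /\
  is_action act /\ (forall g u v, adj u v <-> adj (act g u) (act g v)) /\
  (forall u v, exists g, act g u = v) /\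
  (forall v, compact (stab act v) /\ open (stab act v)).

(** Gromov hyperbolicity of the path metric (four-point condition
    (x|y)_w >= min((x|z)_w, (y|z)_w) - delta, multiplied by 2). *)
Definition gromov_hyperbolic_graph (V : Type) (adj : V -> V -> Prop) : Prop :=
  exists delta : nat, forall x y z w (dxy dxz dyz dxw dyw dzw : nat),
    graph_dist adj x y dxy -> graph_dist adj x z dxz -> graph_dist adj y z dyz ->
    graph_dist adj x w dxw -> graph_dist adj y w dyw -> graph_dist adj z w dzw ->
    Num.min (dxw%:Z + dzw%:Z - dxz%:Z) (dyw%:Z + dzw%:Z - dyz%:Z) - (2 * delta)%:Z
      <= dxw%:Z + dyw%:Z - dxy%:Z.

Definition hyperbolic_group : Prop :=
  compactly_generated /\
  exists (V : Type) (adj : V -> V -> Prop) (act : T -> V -> V),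
    cayley_abels_graph adj act /\ gromov_hyperbolic_graph adj.

Definition proper_fin_Gset (O : choiceType) (act : T -> O -> O) : Prop :=
  is_action act /\
  (forall o, compact (stab act o) /\ open (stab act o)) /\
  (exists s : seq O, forall o, exists g o', o' \in s /\ o = act g o').

(** Elements of the permutation module Q[O]: finitely supported functions. *)
Definition fin_supp (O : choiceType) (x : O -> rat) : Prop :=
  finite_set [set o | x o != 0].

Definition l1norm (O : choiceType) (x : O -> rat) : rat :=
  \sum_(o \in [set: O]) `|x o|.

(** A Q[G]-module map Q[O1] -> Q[O0], given by the images D o of the basis
    elements o (finitely supported, G-equivariant). *)
Definition Gmap (O1 O0 : choiceType) (act1 : T -> O1 -> O1) (act0 : T -> O0 -> O0)
    (D : O1 -> O0 -> rat) : Prop :=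
  (forall o, fin_supp (D o)) /\
  (forall g o o', D (act1 g o) (act0 g o') = D o o').

Definition apply_map (O1 O0 : choiceType) (D : O1 -> O0 -> rat) (x : O1 -> rat)
    : O0 -> rat :=
  fun o' => \sum_(o \in [set: O1]) x o * D o o'.

(** G is of type FP_2, witnessed by a partial proper permutation resolution
    Q[O2] -> Q[O1] -> Q[O0] -> Q -> 0 of finite type, and the weak linear
    isoperimetric inequality holds for it. *)
Definition weak_linear_isoperimetric : Prop :=
  exists (O0 O1 O2 : choiceType) (act0 : T -> O0 -> O0) (act1 : T -> O1 -> O1)
         (act2 : T -> O2 -> O2) (eps : O0 -> rat)
         (D1 : O1 -> O0 -> rat) (D2 : O2 -> O1 -> rat),
    proper_fin_Gset act0 /\ proper_fin_Gset act1 /\ proper_fin_Gset act2 /\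
    (* the augmentation Q[O0] -> Q is a G-map to the trivial module Q *)
    (forall g o, eps (act0 g o) = eps o) /\
    Gmap act1 act0 D1 /\ Gmap act2 act1 D2 /\
    (forall q : rat, exists x, fin_supp x /\ \sum_(o \in [set: O0]) x o * eps o = q) /\
    (forall x : O0 -> rat, fin_supp x ->
       (\sum_(o \in [set: O0]) x o * eps o = 0 <->
        exists y, fin_supp y /\ apply_map D1 y = x)) /\
    (forall x : O1 -> rat, fin_supp x ->
       (apply_map D1 x = (fun _ => 0) <->
        exists y, fin_supp y /\ apply_map D2 y = x)) /\
    (* inf { |y|_1 : d2 y = x } <= C |x|_1  for all x in ker d1 *)
    exists C : rat, 0 < C /\
      forall x : O1 -> rat, fin_supp x -> apply_map D1 x = (fun _ => 0) ->
        forall e : rat, 0 < e ->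
          exists y, fin_supp y /\ apply_map D2 y = x /\ l1norm y <= C * l1norm x + e.

End TDLC.

(* Main.v *)
Require Import Defs.
From HB Require Import structures.
From mathcomp Require Import all_boot all_order all_algebra.
From mathcomp Require Import all_classical all_reals all_analysis.
From mathcomp Require Import finmap zify ring lra.
From Stdlib Require Import Relation_Operators.
Set Implicit Arguments. Unset Strict Implicit. Unset Printing Implicit Defensive.
Import Order.TTheory GRing.Theory Num.Theory.
Local Open Scope classical_set_scope.

(** Let d be the path metric of a Cayley-Abels graph.

    Suppose d satisfies the four-point condition with constant delta, and let
    k = 2 delta + 1. On a closed walk of length at least 2k, the part of length 2k
    centred at a vertex farthest from the start cannot be geodesic. Hence a closed
    walk of length n is emptied by at most n replacements of a piece of length 2k
    by a shorter one. Read in the group, this is a compact presentation. Read in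
    the chain complex of vertices, edges and closed walks of length at most 4k, it
    fills a closed walk of length n with mass at most 2n, and nonnegative rational
    cycles are positive combinations of closed walks.

    Conversely, for 1-Lipschitz functions phi and psi on the vertices, the 1-form
    phi dpsi has a bounded "differential": transported to any resolution of finite
    type, its value on the boundary of a generator of Q[O2] is bounded. So the
    isoperimetric inequality bounds the integral of phi dpsi over a closed walk
    linearly in the length of the walk. Let s be the least slimness constant of
    geodesic triangles of perimeter at most L, attained at p on a side. Then p lies
    on a closed walk of length at most 30 s which meets the ball B(p, s) only in a
    geodesic. With phi = max(0, s - d(p, .)) and psi the distance to a point of that
    geodesic, the integral is at least s^2 / 2, so s is bounded independently of L. *)

(** * Geodesic metrics with values in nat *)

Section GeodesicMetric.
Variables (V : Type) (d : V -> V -> nat).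

Definition geodesic (f : nat -> V) (n : nat) (u v : V) : Prop :=
  [/\ f 0 = u, f n = v & forall i j, i <= j <= n -> d (f i) (f j) = j - i].

Record geodesic_metric : Prop := GeodesicMetric {
  gm_refl : forall u, d u u = 0;
  gm_sym : forall u v, d u v = d v u;
  gm_tri : forall u v w, d u w <= d u v + d v w;
  gm_geod : forall u v, exists f, geodesic f (d u v) u v }.

(** The inequality between Gromov products at [w], rearranged so that no subtraction occurs. *)
Definition four_point (delta : nat) : Prop := forall x y z w,
  d x y + d z w <= maxn (d x z + d y w) (d y z + d x w) + 2 * delta.

Definition lipschitz1 (phi : V -> nat) : Prop :=
  forall u v, phi u <= phi v + d u v.

Definition nearby : rel V := fun u v => d u v <= 1.

(** The Riemann sum of the 1-form phi dpsi, with phi sampled at the start of each step. *)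
Fixpoint walk_integral (phi psi : V -> nat) (x : V) (s : seq V) : int :=
  if s is y :: s' then
    (Posz (phi x) * (Posz (psi y) - Posz (psi x)) + walk_integral phi psi y s')%R
  else 0%R.

Definition linear_integrals (A : nat) : Prop := forall x s phi psi,
  lipschitz1 phi -> lipschitz1 psi -> path nearby x s -> last x s = x ->
  (`|walk_integral phi psi x s| <= (A * size s)%:Z)%R.

(** The bound [L] on the perimeter guarantees that some slimness constant exists, from which the
    argument can descend. *)
Definition slim_upto (L s : nat) : Prop :=
  forall x y z f g h nf ng nh,
    geodesic f nf x y -> geodesic g ng x z -> geodesic h nh y z ->
    nf + ng + nh <= L -> forall t, t <= nf ->
    (exists2 j, j <= ng & d (f t) (g j) <= s) \/
    (exists2 j, j <= nh & d (f t) (h j) <= s).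

Hypothesis gm : geodesic_metric.
Let dxx := gm_refl gm.
Let dC := gm_sym gm.
Let dT := gm_tri gm.

(** Let [f i0] be farthest from [f 0]. The four-point condition for [f 0], [f i0] and the vertices
    [k] steps before and after [f i0] bounds the distance of the last two by k + 2 delta < 2k. *)
Lemma four_point_shortcut delta k n (f : nat -> V) :
  four_point delta -> 2 * delta < k -> k + k <= n -> f 0 = f n ->
  (forall i, i < n -> d (f i) (f i.+1) <= 1) ->
  exists2 i, i + (k + k) <= n & d (f i) (f (i + (k + k))) < k + k.
Proof.
move=> fp ltk len f0n step.
have lip i m : i + m <= n -> d (f i) (f (i + m)) <= m.
  elim: m => [|m IHm] im; first by rewrite addn0 dxx.
  have := dT (f i) (f (i + m)) (f (i + m).+1).
  have := IHm ltac:(lia); have := step (i + m) ltac:(lia).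
  rewrite addnS; lia.
have [i0 _ maxi] := @arg_maxnP _ (ord0 : 'I_n.+1) xpredT (fun i => d (f 0) (f i)) isT.
set M := d (f 0) (f i0).
have leM j : j <= n -> d (f 0) (f j) <= M.
  by rewrite -ltnS => jn; apply: (maxi (Ordinal jn)).
have i0n : i0 <= n by rewrite -ltnS.
(* If the walk stays within less than [k] of its start, its first 2k steps already admit a
   shortcut. *)
have [ltM|leM'] := ltnP M k.
  by exists 0; rewrite ?add0n //; have := leM (k + k) len; lia.
(* Otherwise [k] steps fit on either side of [i0], since reaching [f i0] and returning take at least
   [M] steps each. *)
have Mi : M <= i0 by rewrite /M; have := lip 0 i0; rewrite add0n; apply.
have Mn : M <= n - i0.
  by rewrite /M f0n dC; have := lip i0 (n - i0); rewrite subnKC //; apply.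
exists (i0 - k); first lia.
rewrite ltnNge; apply/negP => geo.
have := fp (f (i0 - k)) (f (i0 - k + (k + k))) (f i0) (f 0).
have E1 : i0 - k + k = i0 by lia.
have := lip (i0 - k) k ltac:(lia); rewrite E1 => d1.
have := lip i0 k ltac:(lia).
have -> : i0 + k = i0 - k + (k + k) by lia.
rewrite dC => d2.
have := leM (i0 - k) ltac:(lia); have := leM (i0 - k + (k + k)) ltac:(lia).
rewrite (dC (f 0) (f _)) (dC (f 0) (f (i0 - k))).
rewrite (dC (f i0) (f 0)) -/M.
lia.
Qed.

Lemma integral_cat phi psi x s t :
  walk_integral phi psi x (s ++ t) =
  (walk_integral phi psi x s + walk_integral phi psi (last x s) t)%R.
Proof. by elim: s x => [|y s IHs] x /=; [rewrite add0r | rewrite IHs addrA]. Qed.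

Lemma geodesic_length f n u v : geodesic f n u v -> d u v = n.
Proof. by case=> <- <- /(_ 0 n); rewrite subn0 leqnn; apply. Qed.

Lemma geodesic_sub f n u v i j : geodesic f n u v -> i <= j <= n ->
  geodesic (fun t => f (i + t)) (j - i) (f i) (f j).
Proof.
move=> [_ _ fd] ij; split; rewrite ?addn0 //; first by congr f; lia.
move=> a b ab; rewrite fd; lia.
Qed.

Lemma geodesic_rev f n u v : geodesic f n u v ->
  geodesic (fun t => f (n - t)) n v u.
Proof.
move=> [f0 fn fd]; split; rewrite ?subn0 ?subnn //.
move=> a b ab; rewrite dC fd; lia.
Qed.

Lemma slim_uptoS L s s' : s <= s' -> slim_upto L s -> slim_upto L s'.
Proof.
move=> ss sl x y z f g h nf ng nh Gf Gg Gh per t tn.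
case: (sl x y z f g h nf ng nh Gf Gg Gh per t tn) => -[j jn dj]; [left|right];
  exists j => //; lia.
Qed.

Lemma slim_upto_trivial L : slim_upto L L.
Proof.
move=> x y z f g h nf ng nh [f0 _ fd] [g0 _ _] _ per t tn; left; exists 0 => //.
rewrite g0 -f0 dC fd; lia.
Qed.

(** * Walks outside a ball *)

Section FarWalks.
Variables (p : V) (r : nat).

(** Walks outside the open ball of radius [r] about [p]. The cut-off phi(q) = max(0, r - d(p, q))
    vanishes on them, so they add nothing to an integral. *)
Inductive far_walk : V -> V -> nat -> Prop :=
| FarNil u : r <= d p u -> far_walk u u 0
| FarCons u v w n : r <= d p u -> nearby u v -> far_walk v w n -> far_walk u w n.+1.

Lemma far_walk_trans u v w m n :
  far_walk u v m -> far_walk v w n -> far_walk u w (m + n).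
Proof.
by elim=> // a b c k ra ab _ IH /IH; rewrite addSn; apply: FarCons.
Qed.

Lemma far_walk_ends u v n : far_walk u v n -> r <= d p u /\ r <= d p v.
Proof. by elim=> // a b c k ra ab _ [_ rc]. Qed.

Lemma far_walk_sym u v n : far_walk u v n -> far_walk v u n.
Proof.
elim=> [a ra|a b c k ra ab bc cb]; first exact: FarNil.
rewrite -addn1; apply: far_walk_trans cb _.
apply: (@FarCons _ a); [by have [] := far_walk_ends bc | by rewrite /nearby dC |].
exact: FarNil.
Qed.

Lemma far_walk_geodesic f n u v i j : geodesic f n u v ->
  (forall t, t <= n -> r <= d p (f t)) -> i <= j <= n ->
  far_walk (f i) (f j) (j - i).
Proof.
move=> [_ _ fd] far /andP[ij jn].
have : i + (j - i) <= n by lia.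
have [m mE] : exists m, m = j - i by exists (j - i).
rewrite -mE; have -> : j = i + m by lia.
elim: m i {mE ij} => [|m IHm] i im; first by rewrite addn0; apply: FarNil; apply: far; lia.
apply: (@FarCons _ (f i.+1)); [by apply: far; lia | by rewrite /nearby fd; lia |].
by have := IHm i.+1; rewrite addSnnS; apply; lia.
Qed.

Lemma far_walk_path phi psi u v n : (forall q, r <= d p q -> phi q = 0) ->
  far_walk u v n ->
  exists s, [/\ path nearby u s, last u s = v, size s = n & walk_integral phi psi u s = 0%R].
Proof.
move=> phi0; elim=> [a ra|a b c k ra ab _ [s [ps ls ss i0]]]; first by exists [::].
by exists (b :: s); split=> //=; [rewrite ab | rewrite ss | rewrite i0 phi0 // mul0r].
Qed.

(** All points of a geodesic from [u] to [v] lie within [s] of [u], hence outside the ball. *)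
Lemma far_walk_short u v s : r + s <= d p u -> d u v <= s ->
  exists2 m, m <= s & far_walk u v m.
Proof.
move=> far duv; have [f Gf] := gm_geod gm u v; exists (d u v) => //.
have := @far_walk_geodesic f _ u v 0 (d u v) Gf; rewrite subn0 leqnn.
case: (Gf) => f0 fn fd; rewrite f0 fn; apply=> // t tn.
have := fd 0 t ltac:(lia); rewrite f0 => e.
have := dT p (f t) u; rewrite (dC (f t)); lia.
Qed.

(** If [z] is within 8r of [g i], the walk goes round through [z]. Otherwise slimness of the
    triangle [g i], [z], [h j], at the point 8r further along [g], lets the walk cross over to [h]
    there and come back. *)
Lemma far_walk_detour L x y z g h ng nh i j :
  0 < r -> slim_upto L r ->
  geodesic g ng x z -> geodesic h nh y z ->
  (forall t, t <= ng -> r <= d p (g t)) ->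
  (forall t, t <= nh -> r <= d p (h t)) ->
  i <= ng -> j <= nh -> d (g i) (h j) <= 6 * r -> d p (g i) <= 3 * r ->
  (ng - i) + (nh - j) + d (g i) (h j) <= L ->
  exists2 m, m <= 24 * r & far_walk (g i) (h j) m.
Proof.
move=> r0 sl Gg Gh fg fh ing jnh dij dpi per.
have [_ gz gd] := Gg; have [_ hz hd] := Gh.
have [le8|gt8] := leqP (ng - i) (8 * r).
  exists ((ng - i) + (nh - j)).
    have e1 : d (h j) z = nh - j by rewrite -hz hd; lia.
    have e2 : d (g i) z = ng - i by rewrite -gz gd; lia.
    have := dT (h j) (g i) z; rewrite (dC (h j) (g i)); lia.
  apply: (@far_walk_trans _ z).
    by rewrite -gz; apply: far_walk_geodesic Gg fg _; lia.
  by apply: far_walk_sym; rewrite -hz; apply: far_walk_geodesic Gh fh _; lia.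
have Gg' : geodesic (fun t => g (i + t)) (ng - i) (g i) z.
  by rewrite -gz; apply: geodesic_sub Gg _; lia.
have Gh' : geodesic (fun t => h (nh - t)) (nh - j) z (h j).
  have /(geodesic_sub (i := 0) (j := nh - j)) := geodesic_rev Gh.
  rewrite !subn0 hz; have -> : nh - (nh - j) = j by lia.
  by apply; lia.
have [a Ga] := gm_geod gm (g i) (h j).
have [a0 aN ad] := Ga.
have per' : (ng - i) + d (g i) (h j) + (nh - j) <= L by lia.
case: (sl _ _ _ _ _ _ _ _ _ Gg' Ga Gh' per' (8 * r) ltac:(lia)) => -[l ll dl].
  (* Points of the third side are within 6r of [g i], so none is within [r] of a point at distance
     8r from [g i]. *)
  exfalso.
  have e1 : d (g i) (a l) = l by rewrite -a0 ad; lia.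
  have e2 : d (g i) (g (i + 8 * r)) = 8 * r by rewrite gd; lia.
  have := dT (g i) (a l) (g (i + 8 * r)); rewrite (dC (a l)); lia.
have dw : d (g i) (g (i + 8 * r)) = 8 * r by rewrite gd; lia.
(* The crossing starts at least 8r - 3r away from [p], so a jump of length at most [r] stays outside
   the ball. *)
have pw : r + r <= d p (g (i + 8 * r)).
  have := dT (g i) p (g (i + 8 * r)); rewrite (dC (g i) p); lia.
have [m ms fm] := far_walk_short pw dl.
(* The return along [h] takes at most 6r + 8r + r steps, for a total of at most 8r + r + 15r =
   24r. *)
exists (8 * r + (m + (nh - l - j))).
  have : d (h j) (h (nh - l)) = nh - l - j by rewrite hd; lia.
  have := dT (h j) (g i) (h (nh - l)).
  have := dT (g i) (g (i + 8 * r)) (h (nh - l)).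
  rewrite (dC (h j) (g i)); lia.
apply: far_walk_trans (far_walk_trans fm _).
  have := @far_walk_geodesic g _ _ _ i (i + 8 * r) Gg fg ltac:(lia).
  by rewrite addKn.
by apply: far_walk_sym; apply: far_walk_geodesic Gh fh _; lia.
Qed.

End FarWalks.

(** * Integrals along geodesics and the bound on slimness *)

Definition geo_segment (f : nat -> V) (i m : nat) : seq V := [seq f t | t <- iota i.+1 m].

Lemma segment_path f n u v i m : geodesic f n u v -> i + m <= n ->
  path nearby (f i) (geo_segment f i m) /\ last (f i) (geo_segment f i m) = f (i + m).
Proof.
move=> [_ _ fd]; elim: m i => [|m IHm] i im /=; first by rewrite addn0.
have [|ps ls] := IHm i.+1; first lia.
by rewrite /nearby fd ?ps /= ?ls ?addSnnS //; last lia; split=> //; lia.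
Qed.

Lemma segment_cat f i m m' :
  geo_segment f i (m + m') = geo_segment f i m ++ geo_segment f (i + m) m'.
Proof. by rewrite /geo_segment iotaD map_cat addSn. Qed.

Lemma integral_segment_ge0 (phi psi : V -> nat) (f : nat -> V) i m :
  (forall t, i <= t < i + m -> psi (f t) <= psi (f t.+1)) ->
  (0 <= walk_integral phi psi (f i) (geo_segment f i m))%R.
Proof.
elim: m i => [//|m IHm] i up /=; rewrite addr_ge0 //.
  by rewrite mulr_ge0 // subr_ge0 lez_nat; apply: up; lia.
by apply: IHm => t it; apply: up; lia.
Qed.

(** The terms are at least m, m - 1, ..., 1; the factor 2 clears the denominator of m(m + 1)/2. *)
Lemma integral_segment_ge (phi psi : V -> nat) (f : nat -> V) i m :
  (forall t, t < m -> m - t <= phi (f (i + t))) ->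
  (forall t, t < m -> (psi (f (i + t))).+1 = psi (f (i + t).+1)) ->
  ((m * m)%:Z <= 2 * walk_integral phi psi (f i) (geo_segment f i m))%R.
Proof.
elim: m i => [//|m IHm] i hphi hpsi /=.
have h1 : ((m * m)%:Z <= 2 * walk_integral phi psi (f i.+1) (geo_segment f i.+1 m))%R.
  apply: IHm => t tm; first by have := hphi t.+1; rewrite addSnnS; lia.
  by have := hpsi t.+1; rewrite addSnnS; apply; lia.
have := hphi 0; have := hpsi 0; rewrite addn0 => /(_ isT) <- /(_ isT).
rewrite subn0 => ph.
have -> : (Posz (psi (f i)).+1 - Posz (psi (f i)) = 1)%R by lia.
rewrite mulr1 -/(geo_segment f i.+1 m).
move: h1; set I := walk_integral _ _ _ _; lia.
Qed.

(** Suppose p = [f t] is at distance at least [s] from both other sides. The part of [f] around p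
    then closes up, outside the ball of radius [s] about p, to a walk of length at most 30s. The
    integral over it is at least s^2/2 and at most 30As, which contradicts s > 60A. *)
Lemma slim_upto_improve A L s : linear_integrals A -> 60 * A < s ->
  slim_upto L s -> slim_upto L s.-1.
Proof.
move=> lin As sl x y z f g h nf ng nh Gf Gg Gh per t tn.
have s0 : 0 < s by lia.
apply: contrapT => /not_orP[ng1 nh1].
have fg j : j <= ng -> s <= d (f t) (g j).
  by move=> jn; rewrite leqNgt; apply/negP => dj; apply: ng1; exists j; lia.
have fh j : j <= nh -> s <= d (f t) (h j).
  by move=> jn; rewrite leqNgt; apply/negP => dj; apply: nh1; exists j; lia.
set p := f t in fg fh.
have [f0 fn fd] := Gf; have [g0 gn gd] := Gg; have [h0 hn hd] := Gh.
pose onside q := (exists2 i, i <= ng & q = g i) \/ (exists2 j, j <= nh & q = h j).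
have sideE q : onside q -> s <= d p q.
  by move=> [[i ? ->]|[i ? ->]]; [apply: fg|apply: fh].
(* At distance 2s from p, slimness gives a jump to another side, too short to enter the ball. *)
have exit i : i <= nf -> d p (f i) = 2 * s ->
    exists q, [/\ onside q, d (f i) q <= s & exists2 m, m <= s & far_walk p s (f i) q m].
  move=> inf dpi; case: (sl _ _ _ _ _ _ _ _ _ Gf Gg Gh per i inf) => -[j jn dj].
    exists (g j); split=> //; first by left; exists j.
    by apply: far_walk_short => //; lia.
  exists (h j); split=> //; first by right; exists j.
  by apply: far_walk_short => //; lia.
have pf i : i <= t -> d p (f i) = t - i by move=> it; rewrite /p dC fd; lia.
have fp i : t <= i <= nf -> d p (f i) = i - t by move=> it; rewrite /p fd; lia.
(* The walk starts on [f] at distance 2s before p, or at the corner [x] if that is nearer; [x]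
   already lies on [g]. *)
have [iu [qu [itu u2 su du [mu mus wu]]]] : exists iu qu,
    [/\ iu <= t, t - iu <= 2 * s, onside qu, d (f iu) qu <= s &
     exists2 m, m <= s & far_walk p s (f iu) qu m].
  have [le2|gt2] := leqP t (2 * s).
    have ox : onside x by left; exists 0.
    exists 0, x; rewrite f0; split=> //; try lia; first by rewrite dxx.
    by exists 0 => //; apply: FarNil; apply: sideE.
  have [|q [sq dq wq]] := exit (t - 2 * s) ltac:(lia); first by rewrite pf; lia.
  by exists (t - 2 * s), q; split=> //; lia.
(* Likewise after p. As [y] lies on [h], it is at least [s] from p, so [s] full steps of [f] remain
   after p. *)
have [iv [qv [itv v2 sv dv [mv mvs wv]]]] : exists iv qv,
    [/\ t + s <= iv <= nf, iv - t <= 2 * s, onside qv, d (f iv) qv <= s &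
     exists2 m, m <= s & far_walk p s (f iv) qv m].
  have [le2|gt2] := leqP (nf - t) (2 * s).
    have oy : onside y by right; exists 0.
    have := sideE _ oy; rewrite -{1}fn fp ?tn ?leqnn // => tnf.
    exists nf, y; rewrite fn; split=> //; try lia; first by rewrite dxx.
    by exists 0 => //; apply: FarNil; apply: sideE.
  have [|q [sq dq wq]] := exit (t + 2 * s) ltac:(lia); first by rewrite fp; lia.
  by exists (t + 2 * s), q; split=> //; lia.
have duv : d qv qu <= 6 * s.
  have := dT qv (f iv) qu; have := dT (f iv) (f iu) qu.
  have := fd iu iv ltac:(lia); rewrite (dC (f iu) (f iv)) (dC qv (f iv)); lia.
have dpu : d p qu <= 3 * s.
  have := dT p (f iu) qu; have := pf iu itu; lia.
have dpv : d p qv <= 3 * s.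
  have := dT p (f iv) qv; have := fp iv ltac:(lia); lia.
(* The triangle [g i], [z], [h j] has at most the original perimeter: the third side is no longer
   than the route through [x] and [y]. *)
have back i j : i <= ng -> j <= nh ->
    (ng - i) + (nh - j) + d (g i) (h j) <= L.
  move=> ing jnh; have := dT (g i) x (h j); have := dT x y (h j).
  have := geodesic_length Gf.
  have e1 : d (g i) x = i by rewrite dC -g0 gd; lia.
  have e2 : d y (h j) = j by rewrite -h0 hd; lia.
  lia.
(* Exits on the same side are joined along that side, exits on different sides by
   [far_walk_detour]. *)
have [mb mbs wb] : exists2 m, m <= 24 * s & far_walk p s qv qu m.
  case: (sv) (su) => -[a an ea] [] [b bn eb]; rewrite ea eb in duv dpu dpv *.
  - have Gd := far_walk_geodesic Gg fg.
    case: (leqP a b) => ab.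
      by exists (b - a); [move: duv; rewrite gd; lia | apply: Gd; lia].
    exists (a - b); first by move: duv; rewrite dC gd; lia.
    by apply: far_walk_sym; apply: Gd; lia.
  - exact: (far_walk_detour s0 sl Gg Gh fg fh an bn duv dpv (back _ _ an bn)).
  - rewrite dC in duv.
    have [m ml w] := far_walk_detour s0 sl Gg Gh fg fh bn an duv dpu (back _ _ bn an).
    by exists m => //; apply: far_walk_sym.
  - have Gd := far_walk_geodesic Gh fh.
    case: (leqP a b) => ab.
      by exists (b - a); [move: duv; rewrite hd; lia | apply: Gd; lia].
    exists (a - b); first by move: duv; rewrite dC hd; lia.
    by apply: far_walk_sym; apply: Gd; lia.
have w := far_walk_trans wv (far_walk_trans wb (far_walk_sym wu)).
pose phi q := s - d p q; pose psi q := d (f iu) q.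
have [c [pc lc sc ic]] := @far_walk_path p s phi psi _ _ _ ltac:(move=> q; rewrite /phi; lia) w.
have [|ps ls] := @segment_path f nf x y iu (iv - iu) Gf; first lia.
have Eiv : iu + (iv - iu) = iv by lia.
rewrite Eiv in ls.
have lphi : lipschitz1 phi.
  by move=> a b; rewrite /phi; have := dT p a b; have := dC a b; lia.
have lpsi : lipschitz1 psi.
  by move=> a b; rewrite /psi; have := dT (f iu) b a; rewrite (dC b); lia.
have := lin (f iu) (geo_segment f iu (iv - iu) ++ c) phi psi lphi lpsi.
rewrite cat_path last_cat ps ls pc lc => /(_ isT erefl).
rewrite integral_cat ls ic addr0 size_cat size_map size_iota sc.
(* The [s] steps right after p contribute at least s^2/2, the steps before and beyond them at least
   0. *)
have E : iv - iu = (t - iu) + (s + (iv - iu - (t - iu) - s)) by lia.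
rewrite {1}E !segment_cat !integral_cat.
have up i : iu <= i < iv -> (psi (f i)).+1 = psi (f i.+1).
  by move=> ii; rewrite /psi !fd; lia.
have [|_ l1] := @segment_path f nf x y iu (t - iu) Gf; first lia.
have [|_ l2] := @segment_path f nf x y (iu + (t - iu)) s Gf; first lia.
rewrite l1 l2.
have := @integral_segment_ge0 phi psi f iu (t - iu).
have := @integral_segment_ge0 phi psi f (iu + (t - iu) + s) (iv - iu - (t - iu) - s).
have := @integral_segment_ge phi psi f (iu + (t - iu)) s.
set I2 := walk_integral _ _ (f (_ + (t - iu))) _.
set I1 := walk_integral _ _ (f iu) _.
set I3 := walk_integral _ _ _ _.
have -> : iu + (t - iu) = t by lia.
move=> h2 h3 h1.
have {}h1 : (0 <= I1)%R by apply: h1 => i ii; rewrite -up; lia.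
have {}h3 : (0 <= I3)%R by apply: h3 => i ii; rewrite -up; lia.
have {}h2 : ((s * s)%:Z <= 2 * I2)%R.
  apply: h2 => i ii; first by rewrite /phi fp; lia.
  by rewrite up; lia.
(* 30s = 4s + s + 24s + s: the segment of [f], the jump from [f iv], the walk between the sides, the
   jump back to [f iu]. *)
have : A * (iv - iu + (mv + (mb + mu))) <= A * (30 * s) by rewrite leq_mul2l; lia.
have : (60 * A).+1 * s <= s * s by rewrite leq_mul2r; lia.
nia.
Qed.

(** The trivial constant is lowered one unit at a time as long as it exceeds 60A; the outcome does
    not depend on [L]. *)
Lemma slim_of_linear_integrals A L : linear_integrals A -> slim_upto L (60 * A).
Proof.
move=> lin; have : slim_upto L (60 * A + L).
  by apply: (@slim_uptoS L L) (slim_upto_trivial (L := L)); lia.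
elim: {2}L => [|n IHn]; first by rewrite addn0.
by rewrite addnS => sl; apply: IHn; apply: (slim_upto_improve lin _ sl); lia.
Qed.

(** Some point of a geodesic from [x] to [y] is close to both geodesics to [w], so its distance to
    [w] is at most (x|y)_w + 2s + 1. It is also [s]-close to a side ending at [z], so this distance
    is at least min((x|z)_w, (y|z)_w) - s. *)
Lemma four_point_of_slim s : (forall L, slim_upto L s) -> four_point (3 * s + 1).
Proof.
move=> sl.
have gromov x y w f : geodesic f (d x y) x y ->
    exists2 t, t <= d x y & 2 * d w (f t) + d x y <= d x w + d y w + 4 * s + 2.
  move=> Gf; have [f0 fn fd] := Gf.
  have [g Gg] := gm_geod gm x w; have [h Gh] := gm_geod gm y w.
  have [g0 gn gd] := Gg; have [h0 hn hd] := Gh.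
  pose P t := exists2 j, j <= d x w & d (f t) (g j) <= s.
  pose Q t := exists2 j, j <= d y w & d (f t) (h j) <= s.
  have PQ t : t <= d x y -> P t \/ Q t.
    by move=> tn; apply: (sl _ x y w f g h _ _ _ Gf Gg Gh (leqnn _) t tn).
  have P0 : P 0 by exists 0; rewrite // f0 g0 dxx.
  have Qn : Q (d x y) by exists 0; rewrite // fn h0 dxx.
  (* Discrete connectedness: [P] holds at the start, [Q] at the end and one of them everywhere, so
     both hold at some [t], or [P] at [t] and [Q] one step later. *)
  have [t tn [Pt [Qt|[tn' Qt]]]] : exists2 t, t <= d x y & P t /\ (Q t \/ (t < d x y /\ Q t.+1)).
    have : forall m, m <= d x y -> P m \/ (exists2 t, t <= d x y & P t /\ (Q t \/ (t < d x y /\ Q t.+1))).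
      elim=> [|m IHm] mn; first by left.
      have [Pm|] := IHm ltac:(lia); last by right.
      have [|Qm] := PQ m.+1 mn; [by left | right; exists m; first lia].
      by split=> //; right.
    move=> /(_ _ (leqnn _))[Pn|//]; exists (d x y) => //; by split=> //; left.
  - case: Pt => i ile di; case: Qt => j jle dj; exists t => //.
    have e1 : d x (f t) = t by rewrite -f0 fd; lia.
    have e2 : d y (f t) = d x y - t by rewrite dC -{1}fn fd; lia.
    have e3 : d x (g i) = i by rewrite -g0 gd; lia.
    have e4 : d w (g i) = d x w - i by rewrite dC -{1}gn gd; lia.
    have e5 : d y (h j) = j by rewrite -h0 hd; lia.
    have e6 : d w (h j) = d y w - j by rewrite dC -{1}hn hd; lia.
    have := dT x (g i) (f t); have := dT y (h j) (f t).
    have := dT w (g i) (f t); have := dT w (h j) (f t).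
    rewrite (dC (g i)) (dC (h j)); lia.
  - case: Pt => i ile di; case: Qt => j jle dj; exists t => //.
    have e0 : d (f t) (f t.+1) = 1 by rewrite fd; lia.
    have e1 : d x (f t) = t by rewrite -f0 fd; lia.
    have e2 : d y (f t) = d x y - t by rewrite dC -{1}fn fd; lia.
    have e3 : d x (g i) = i by rewrite -g0 gd; lia.
    have e4 : d w (g i) = d x w - i by rewrite dC -{1}gn gd; lia.
    have e5 : d y (h j) = j by rewrite -h0 hd; lia.
    have e6 : d w (h j) = d y w - j by rewrite dC -{1}hn hd; lia.
    have e7 := dT (f t) (f t.+1) (h j).
    have := dT x (g i) (f t); have := dT y (h j) (f t).
    have := dT w (g i) (f t); have := dT w (h j) (f t).
    rewrite (dC (g i)) (dC (h j)); lia.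
move=> x y z w.
have [f Gf] := gm_geod gm x y; have [g Gg] := gm_geod gm x z.
have [h Gh] := gm_geod gm y z.
have [t tn dt] := gromov x y w f Gf.
have [_ _ gd] := Gg; have [_ _ hd] := Gh.
case: (sl _ x y z f g h _ _ _ Gf Gg Gh (leqnn _) t tn) => -[j jn dj].
- have [g0 gn _] := Gg.
  have e1 : d x (g j) = j by rewrite -g0 gd; lia.
  have e2 : d z (g j) = d x z - j by rewrite dC -{1}gn gd; lia.
  have := dT x (g j) w; have := dT z (g j) w; have := dT (g j) (f t) w.
  rewrite (dC (g j) (f t)) (dC (f t) w); lia.
- have [h0 hn _] := Gh.
  have e1 : d y (h j) = j by rewrite -h0 hd; lia.
  have e2 : d z (h j) = d y z - j by rewrite dC -{1}hn hd; lia.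
  have := dT y (h j) w; have := dT z (h j) w; have := dT (h j) (f t) w.
  rewrite (dC (h j) (f t)) (dC (f t) w); lia.
Qed.

Lemma four_point_of_linear_integrals A :
  linear_integrals A -> four_point (180 * A + 1).
Proof.
move=> lin; have := @four_point_of_slim (60 * A) (fun L => slim_of_linear_integrals (L := L) lin).
by rewrite mulnA.
Qed.

End GeodesicMetric.

(** * Topological groups and Cayley-Abels graphs *)

Lemma finite_set_nat_bound (X : Type) (A : set X) (P : X -> nat -> Prop) :
  finite_set A -> (forall x m n, m <= n -> P x m -> P x n) ->
  (forall x, A x -> exists n, P x n) -> exists N, forall x, A x -> P x N.
Proof.
move=> finA mono AP.
have /choice[f fP] : forall x, exists n, A x -> P x n.
  move=> x; case: (pselect (A x)) => [/AP[n Pn]|nA]; first by exists n.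
  by exists 0.
have /finite_seqP[s sE] := finite_image f finA.
exists (\max_(i <- s) i) => x Ax; apply: mono (fP x Ax).
have xs : f x \in s.
  by have : [set` s] (f x) by rewrite -sE; exists x.
by rewrite (big_rem _ xs) /= leq_maxl.
Qed.

Section TopologicalGroup.
Variables (T : topologicalType) (mul : T -> T -> T) (inv : T -> T) (one : T).
Hypothesis tdlc : is_tdlc_group mul inv one.

Lemma tg_mulA x y z : mul x (mul y z) = mul (mul x y) z.
Proof. by have [h _] := tdlc. Qed.
Lemma tg_mul1 x : mul one x = x.
Proof. by have [_ [h _]] := tdlc. Qed.
Lemma tg_mulV x : mul (inv x) x = one.
Proof. by have [_ [_ [h _]]] := tdlc. Qed.
Lemma tg_mulrV x : mul x (inv x) = one.
Proof.
rewrite -[mul x (inv x)]tg_mul1 -{1}(tg_mulV (inv x)) -tg_mulA (tg_mulA (inv x) x).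
by rewrite tg_mulV tg_mul1 tg_mulV.
Qed.
Lemma tg_mulr1 x : mul x one = x.
Proof. by rewrite -(tg_mulV x) tg_mulA tg_mulrV tg_mul1. Qed.
Lemma tg_mulKV x y : mul x (mul (inv x) y) = y.
Proof. by rewrite tg_mulA tg_mulrV tg_mul1. Qed.
Lemma tg_mulVK x y : mul (inv x) (mul x y) = y.
Proof. by rewrite tg_mulA tg_mulV tg_mul1. Qed.
Lemma tg_invM x y : inv (mul x y) = mul (inv y) (inv x).
Proof.
by rewrite -[RHS](tg_mulVK (mul x y)) -(tg_mulA x) tg_mulKV tg_mulrV tg_mulr1.
Qed.
Lemma tg_invK x : inv (inv x) = x.
Proof. by rewrite -[RHS]tg_mul1 -(tg_mulV (inv x)) -tg_mulA tg_mulV tg_mulr1. Qed.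
Lemma tg_inv1 : inv one = one.
Proof. by rewrite -[LHS]tg_mulr1 tg_mulV. Qed.

Lemma tg_hausdorff : hausdorff_space T.
Proof. by have [_ [_ [_ [_ [_ [h _]]]]]] := tdlc. Qed.

Lemma continuous_lmul g : continuous (mul g).
Proof.
have [_ [_ [_ [mulC _]]]] := tdlc.
move=> h.
apply: (@continuous_comp _ _ _ (fun h => (g, h)) (fun p => mul p.1 p.2)); last exact: mulC.
by apply: cvg_pair => //=; apply: cvg_cst.
Qed.

(** * Actions with open or compact stabilizers *)

Section Action.
Variables (V : Type) (act : T -> V -> V).
Hypothesis actP : is_action mul one act.

Lemma act1 v : act one v = v. Proof. by have [h _] := actP. Qed.
Lemma actM g h v : act (mul g h) v = act g (act h v).
Proof. by have [_ h'] := actP. Qed.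
Lemma actVK g v : act (inv g) (act g v) = v.
Proof. by rewrite -actM tg_mulV act1. Qed.
Lemma actKV g v : act g (act (inv g) v) = v.
Proof. by rewrite -actM tg_mulrV act1. Qed.
Lemma act_inj g : injective (act g).
Proof. by move=> u v e; rewrite -(actVK g u) e actVK. Qed.

Lemma transporterE g v :
  [set h | act h v = act g v] = mul (inv g) @^-1` stab act v.
Proof.
apply/seteqP; split=> h /=; rewrite /stab /= actM => e; first by rewrite e actVK.
by rewrite -{2}e actKV.
Qed.

Lemma open_transporter v w : open (stab act v) -> open [set h | act h v = w].
Proof.
move=> oS; case: (pselect (exists g, act g v = w)) => [[g <-]|no].
  by rewrite transporterE; apply: open_comp => // x _; apply: continuous_lmul.
rewrite (_ : mkset _ = set0); first exact: open0.
by apply/seteqP; split=> // h /= e; apply: no; exists h.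
Qed.

Lemma compact_transporter v w : compact (stab act v) -> compact [set h | act h v = w].
Proof.
move=> cS; case: (pselect (exists g, act g v = w)) => [[g <-]|no]; last first.
  rewrite (_ : mkset _ = set0); first exact: compact0.
  by apply/seteqP; split=> // h /= e; apply: no; exists h.
rewrite (_ : mkset _ = mul g @` stab act v).
  by apply: continuous_compact => //; apply/continuous_subspaceT/continuous_lmul.
apply/seteqP; split=> h /=; last by move=> [k kv <-]; rewrite actM kv.
by move=> e; exists (mul (inv g) h); rewrite ?tg_mulKV // /stab /= actM e actVK.
Qed.

(** The sets of elements sending [v] to a given point are open and cover [K], so finitely many
    suffice. *)
Lemma finite_compact_orbit (K : set T) v : compact K -> open (stab act v) ->
  finite_set ((fun g => act g v) @` K).
Proof.
move=> cK oS.
pose pT : ptopologicalType := HB.pack T (isPointed.Build T one).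
have : @compact pT K by [].
rewrite compact_cover => /(_ {classic V} setT (fun w => [set h | act h v = w])).
case=> [w _|g _|D _ KD]; [exact: open_transporter | by exists (act g v) |].
pose F : set {classic V} := [set w | w \in D].
have finF : @finite_set V F by exact: (@finite_fset {classic V} D).
apply: sub_finite_set finF.
move=> _ /= [g Kg <-].
by have [w wD /= ->] := KD g Kg.
Qed.

End Action.

(** * The path metric of a connected graph *)

Section GraphMetric.
Variables (V : Type) (adj : V -> V -> Prop).
Hypothesis adjC : forall u v, adj u v -> adj v u.
Hypothesis conn : forall u v, exists n, walk adj u v n.

Lemma walk_trans u v w m n : walk adj u v m -> walk adj v w n -> walk adj u w (m + n).
Proof.
move=> [f [f0 [fm fs]]] [g [g0 [gn gs]]].
exists (fun i => if i <= m then f i else g (i - m)); split=> //; split.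
  case: leqP => [le|_]; last by rewrite addKn.
  have n0 : n = 0 by lia.
  by rewrite n0 addn0 fm -g0 -gn n0.
move=> i imn; case: (ltngtP i m) => im.
- by apply: fs.
- rewrite subSn; last lia.
  by apply: gs; lia.
- by rewrite im subSn // subnn fm -g0; apply: gs; lia.
Qed.

Lemma walk_sym u v n : walk adj u v n -> walk adj v u n.
Proof.
move=> [f [f0 [fn fs]]]; exists (fun i => f (n - i)); rewrite subn0 subnn; split=> //.
split=> // i ilt; apply: adjC.
have -> : n - i = (n - i.+1).+1 by lia.
by apply: fs; lia.
Qed.

Lemma graph_dist_exists : exists d, forall u v, graph_dist adj u v (d u v).
Proof.
suff /choice[d dP] : forall u, exists f, forall v, graph_dist adj u v (f v) by exists d.
move=> u; suff /choice[f fP] : forall v, exists n, graph_dist adj u v n by exists f.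
move=> v; have [n wn] := conn u v.
pose P m := `[< walk adj u v m >].
have exP : exists m, P m by exists n; apply/asboolP.
exists (ex_minn exP); case: ex_minnP => m /asboolP wm mmin; split=> // k wk.
by apply: mmin; apply/asboolP.
Qed.

Variable d : V -> V -> nat.
Hypothesis dP : forall u v, graph_dist adj u v (d u v).

Lemma graph_dist_unique u v n : graph_dist adj u v n -> n = d u v.
Proof.
move=> [wn nmin]; have [wd dmin] := dP u v.
by apply/eqP; rewrite eqn_leq nmin // dmin.
Qed.

Lemma graph_dist_eq0 u v : d u v = 0 -> u = v.
Proof. by have [[f [f0 [fd _]]] _] := dP u v => d0; rewrite -f0 -fd d0. Qed.

Lemma graph_geodesic_metric : geodesic_metric d.
Proof.
have dT u v w : d u w <= d u v + d v w.
  by have [_] := dP u w; apply; have [+ _] := dP u v; have [+ _] := dP v w;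
    move=> ? ?; apply: walk_trans; eauto.
split=> //.
- move=> u; apply/eqP; rewrite -leqn0; have [_] := dP u u; apply.
  by exists (fun=> u).
- move=> u v; apply/eqP; rewrite eqn_leq; apply/andP; split.
    by have [_] := dP u v; apply; apply: walk_sym; have [] := dP v u.
  by have [_] := dP v u; apply; apply: walk_sym; have [] := dP u v.
- move=> u v; have [[f [f0 [fd fs]]] _] := dP u v; exists f; split=> // i j ij.
  (* Each piece of a shortest walk bounds the distance of its ends from above. Three pieces add up
     to [d u v], so all these bounds are equalities. *)
  have le a b : a <= b <= d u v -> d (f a) (f b) <= b - a.
    move=> ab; have [_] := dP (f a) (f b); apply.
    exists (fun k => f (a + k)); rewrite addn0 subnKC; last lia.
    by split=> //; split=> // k kb; rewrite addnS; apply: fs; lia.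
  have := le i j ij; have := le 0 i; have := le j (d u v).
  rewrite f0 fd.
  have := dT u (f i) v; have := dT (f i) (f j) v; lia.
Qed.

Lemma graph_finite_ball : (forall v, finite_set [set u | adj v u]) ->
  forall v R, finite_set [set u | d v u <= R].
Proof.
move=> nbr v; elim=> [|R IHR].
  apply: sub_finite_set (finite_set1 v) => u /=.
  by rewrite leqn0 => /eqP/graph_dist_eq0 ->.
apply: (@sub_finite_set _ _ (\bigcup_(w in [set u | d v u <= R]) ([set w] `|` [set u | adj w u]))).
  move=> u /= duR; have [le|gt] := leqP (d v u) R.
    by exists u => //; left.
  have [[f [f0 [fd fs]]] _] := dP v u.
  have E : d v u = R.+1 by lia.
  exists (f R) => /=; last by right => /=; rewrite -fd E; apply: fs; lia.
  have [_] := dP v (f R); apply; exists f; split=> //; split=> // i iR.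
  by apply: fs; lia.
by apply: bigcup_finite => // w _; rewrite finite_setU; split; [exact: finite_set1|].
Qed.

Lemma graph_dist_act (act : T -> V -> V) : is_action mul one act ->
  (forall g u v, adj u v <-> adj (act g u) (act g v)) ->
  forall g u v, d (act g u) (act g v) = d u v.
Proof.
move=> actP inva.
have le g u v : d (act g u) (act g v) <= d u v.
  have [[f [f0 [fd fs]]] _] := dP u v.
  have [_] := dP (act g u) (act g v); apply; exists (act g \o f).
  by rewrite /= f0 fd; split=> //; split=> // i idn; exact: (proj1 (inva g _ _) (fs i idn)).
move=> g u v; apply/eqP; rewrite eqn_leq le /=.
by rewrite -{1}(actVK actP g u) -{1}(actVK actP g v) le.
Qed.

Lemma gromov_hyperbolicE :
  gromov_hyperbolic_graph adj <-> exists delta, four_point d delta.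
Proof.
split=> -[delta H]; exists delta => x y z w.
  have := H x y z w _ _ _ _ _ _ (dP _ _) (dP _ _) (dP _ _) (dP _ _) (dP _ _) (dP _ _).
  lia.
move=> dxy dxz dyz dxw dyw dzw.
do 6 move=> /graph_dist_unique->.
have := H x y z w; lia.
Qed.

End GraphMetric.

(** A Cayley-Abels graph seen through its path metric alone; finite balls stand for local
    finiteness. *)
Record ca_metric (V : Type) (act : T -> V -> V) (d : V -> V -> nat) : Prop := CaMetric {
  ca_action : is_action mul one act;
  ca_metricP : geodesic_metric d;
  ca_invariant : forall g u v, d (act g u) (act g v) = d u v;
  ca_transitive : forall u v, exists g, act g u = v;
  ca_ball : forall v R, finite_set [set u | d v u <= R];
  ca_stab : forall v, compact (stab act v) /\ open (stab act v) }.

Lemma cayley_abels_metric (V : Type) (adj : V -> V -> Prop) (act : T -> V -> V) :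
  cayley_abels_graph mul one adj act -> exists2 d, ca_metric act d &
    (gromov_hyperbolic_graph adj <-> exists delta, four_point d delta).
Proof.
move=> [_ [adjC [_ [nbr [conn [actP [inva [tr stb]]]]]]]].
have [d dP] := graph_dist_exists conn.
exists d; last exact: (gromov_hyperbolicE dP).
split=> //.
- exact: (graph_geodesic_metric adjC dP).
- exact: (graph_dist_act dP actP inva).
- exact: (graph_finite_ball dP nbr).
Qed.

Lemma ca_compact_bound (V : Type) (act : T -> V -> V) d (K : set T) v :
  ca_metric act d -> compact K -> exists M, forall h, K h -> d v (act h v) <= M.
Proof.
move=> ca cK.
have [||N HN] := @finite_set_nat_bound _ _ (fun u n => d v u <= n)
  (finite_compact_orbit (ca_action ca) cK (proj2 (ca_stab ca v))).
- by move=> x m n mn /leq_trans; apply.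
- by move=> u _; exists (d v u).
by exists N => h Kh; apply: HN; exists h.
Qed.

(* The graph with an edge between g v0 and g k v0 for every g and every k in
   the compact generating set K. *)
Lemma cayley_abels_exists (V : Type) (act : T -> V -> V) (v0 : V) :
  compactly_generated mul inv one -> is_action mul one act ->
  (forall v, exists g, act g v0 = v) ->
  (forall v, compact (stab act v) /\ open (stab act v)) ->
  exists adj, cayley_abels_graph mul one adj act.
Proof.
move=> [K [cK gK]] actP tr stb.
pose arc u v := exists g k, [/\ K k, u = act g v0 & v = act g (act k v0)].
pose adj u v := u <> v /\ (arc u v \/ arc v u).
have arc_act g u v : arc u v -> arc (act g u) (act g v).
  by move=> [h [k [Kk -> ->]]]; exists (mul g h), k; rewrite !actM.
have adj_act g u v : adj u v -> adj (act g u) (act g v).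
  move=> [nuv auv]; split; first by move/(act_inj actP).
  by case: auv => auv; [left|right]; apply: arc_act.
have tr2 u v : exists g, act g u = v.
  have [g <-] := tr u; have [h <-] := tr v; exists (mul h (inv g)).
  by rewrite actM // actVK.
have walk_act g u v n : walk adj u v n -> walk adj (act g u) (act g v) n.
  move=> [f [f0 [fn fs]]]; exists (act g \o f); rewrite /= f0 fn.
  by split=> //; split=> // i ilt; apply: adj_act; apply: fs.
have adjC u v : adj u v -> adj v u.
  by move=> [n [a|a]]; split; [move=> e; apply: n|right|move=> e; apply: n|left].
have step u v : arc u v \/ arc v u -> exists n, walk adj u v n.
  move=> auv; case: (pselect (u = v)) => [->|nuv]; first by exists 0, (fun=> v).
  exists 1, (fun i => if i is 0 then u else v); split=> //; split=> // -[|//] _.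
  by split.
have conn0 w : word_over K w -> exists n, walk adj v0 (act (eval_word mul inv one w) v0) n.
  elim: w => [|l w IHw] Kw /=; first by exists 0, (fun=> v0); rewrite act1.
  have [n wn] : exists n, walk adj v0 (act (eval_word mul inv one w) v0) n.
    by apply: IHw => m mw; apply: Kw; rewrite inE mw orbT.
  have Kl : K l.2 by apply: Kw; rewrite inE eqxx.
  have [m wm] : exists m, walk adj v0 (act (letter_val inv l) v0) m.
    apply: step; rewrite /letter_val; case: l.1; last first.
      by left; exists one, l.2; split; rewrite ?act1.
    by right; exists (inv l.2), l.2; split; rewrite // actVK.
  exists (m + n); apply: walk_trans wm _; rewrite actM //; exact: walk_act.
exists adj; split; first by exists v0.
split=> //; split; first by move=> v [].
split.
  move=> v; have [g <-] := tr v.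
  (* A neighbour of g v0 has the form g h k v0 or g h k^-1 v0 with h fixing v0 and k in [K].
     Finiteness follows from two compact orbits: first of [K] or its inverse, then of the
     stabilizer. *)
  apply: (@sub_finite_set _ _ (act g @`
    (\bigcup_(w in (fun k => act k v0) @` K) ((fun h => act h w) @` stab act v0) `|`
     \bigcup_(w in (fun k => act k v0) @` (inv @` K)) ((fun h => act h w) @` stab act v0)))).
    move=> u [_ [[h [k [Kk e ->]]]|[h [k [Kk -> e]]]]].
      exists (act (mul (inv g) h) (act k v0)); last by rewrite actM // actKV.
      left; exists (act k v0); first by exists k.
      by exists (mul (inv g) h) => //; rewrite /stab /= actM // -e actVK.
    exists (act (inv g) (act h v0)); last by rewrite actKV.
    right; exists (act (inv k) v0); first by exists (inv k) => //; exists k.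
    exists (mul (inv g) (mul h k)).
      by rewrite /stab /= !actM // -e actVK.
    by rewrite !actM // actKV.
  have cVK : compact (inv @` K).
    have [_ [_ [_ [_ [invC _]]]]] := tdlc.
    by apply: continuous_compact => //; apply: continuous_subspaceT.
  apply: finite_image; rewrite finite_setU; split; apply: bigcup_finite.
  - by apply: finite_compact_orbit => //; have [] := stb v0.
  - by move=> w _; apply: finite_compact_orbit => //; [have [] := stb v0|have [] := stb w].
  - by apply: finite_compact_orbit => //; have [] := stb v0.
  - by move=> w _; apply: finite_compact_orbit => //; [have [] := stb v0|have [] := stb w].
split.
  move=> u v; have [g <-] := tr u; have [h <-] := tr v.
  have [w [Kw ew]] := gK (mul (inv g) h).
  have [n wn] := conn0 w Kw; exists n.
  by have := walk_act g _ _ _ wn; rewrite ew actM // actKV.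
split=> //; split; last by split.
move=> g u v; split; first exact: adj_act.
by move=> /(adj_act (inv g)); rewrite !actVK.
Qed.

End TopologicalGroup.

(** * Finitely supported chains *)

Section Chains.
Local Open Scope ring_scope.
Variable O : choiceType.
Implicit Types (x y F : O -> rat).

(** Evaluation of a cochain [F], of arbitrary support, on a chain [x]. The values of [apply_map] and
    of the augmentation are pairings by conversion. *)
Definition pairing x F : rat := \sum_(o \in [set: O]) x o * F o.

Definition delta (o : O) : O -> rat := fun o' => (o' == o)%:R.

Lemma fsum_seq (F : O -> rat) (s : seq O) : uniq s ->
  (forall o, o \notin s -> F o = 0) -> \sum_(o \in [set: O]) F o = \sum_(o <- s) F o.
Proof.
move=> us Fs; rewrite (fsbigE s) //; last by move=> o _; apply: Fs.
by apply: eq_bigl => o; rewrite in_setT.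
Qed.

Lemma fin_suppP x :
  fin_supp x <-> exists2 s : seq O, uniq s & forall o, o \notin s -> x o = 0.
Proof.
split=> [/finite_seqP[s sE]|[s us s0]].
  exists (undup s); first exact: undup_uniq.
  move=> o; rewrite mem_undup => os; apply/eqP/negPn/negP => xo.
  by move/negP: os; apply; have : [set` s] o by rewrite -sE.
apply: sub_finite_set (finite_seq s) => o /= xo; apply/negPn/negP => os.
by rewrite s0 ?eqxx in xo.
Qed.

Lemma fin_supp_subseq x (s : seq O) : (forall o, o \notin s -> x o = 0) -> fin_supp x.
Proof.
move=> xs; apply/fin_suppP; exists (undup s); first exact: undup_uniq.
by move=> o; rewrite mem_undup; apply: xs.
Qed.

Lemma fin_supp2P x y : fin_supp x -> fin_supp y -> exists s : seq O,
  [/\ uniq s, forall o, o \notin s -> x o = 0 & forall o, o \notin s -> y o = 0].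
Proof.
move=> /fin_suppP[s us xs] /fin_suppP[t ut yt]; exists (undup (s ++ t)).
split=> [|o|o]; rewrite ?undup_uniq // mem_undup mem_cat negb_or => /andP[os ot].
  exact: xs.
exact: yt.
Qed.

Lemma fin_supp0 : fin_supp (fun _ : O => 0 : rat).
Proof. by apply: (@fin_supp_subseq _ [::]). Qed.

Lemma fin_supp_delta o : fin_supp (delta o).
Proof.
by apply: (@fin_supp_subseq _ [:: o]) => o'; rewrite inE /delta => /negbTE->.
Qed.

Lemma fin_suppD x y : fin_supp x -> fin_supp y -> fin_supp (fun o => x o + y o).
Proof.
move=> fx fy; have [s [_ xs ys]] := fin_supp2P fx fy.
by apply: (@fin_supp_subseq _ s) => o os; rewrite xs // ys // addr0.
Qed.

Lemma fin_suppZ a x : fin_supp x -> fin_supp (fun o => a * x o).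
Proof.
by move=> /fin_suppP[s us xs]; apply: (@fin_supp_subseq _ s) => o /xs->; rewrite mulr0.
Qed.

Lemma pairing_seq x F s : uniq s -> (forall o, o \notin s -> x o = 0) ->
  pairing x F = \sum_(o <- s) x o * F o.
Proof. by move=> us xs; apply: fsum_seq => // o /xs->; rewrite mul0r. Qed.

Lemma l1norm_seq x s : uniq s -> (forall o, o \notin s -> x o = 0) ->
  l1norm x = \sum_(o <- s) `|x o|.
Proof. by move=> us xs; apply: fsum_seq => // o /xs->; rewrite normr0. Qed.

Lemma pairing_eq x F F' : (forall o, x o != 0 -> F o = F' o) ->
  pairing x F = pairing x F'.
Proof.
move=> FF; apply: eq_fsbigr => o _.
by have [->|/FF->//] := eqVneq (x o) 0; rewrite !mul0r.
Qed.

Lemma pairingDl x y F : fin_supp x -> fin_supp y ->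
  pairing (fun o => x o + y o) F = pairing x F + pairing y F.
Proof.
move=> fx fy; have [s [us xs ys]] := fin_supp2P fx fy.
rewrite !(@pairing_seq _ _ s) // => [|o os]; last by rewrite xs // ys // addr0.
by rewrite -big_split; apply: eq_bigr => o _; rewrite mulrDl.
Qed.

Lemma pairingZl a x F : fin_supp x -> pairing (fun o => a * x o) F = a * pairing x F.
Proof.
move=> /fin_suppP[s us xs].
rewrite !(@pairing_seq _ _ s) // => [|o os]; last by rewrite xs // mulr0.
by rewrite mulr_sumr; apply: eq_bigr => o _; rewrite mulrA.
Qed.

Lemma pairingDr x F F' : fin_supp x ->
  pairing x (fun o => F o + F' o) = pairing x F + pairing x F'.
Proof.
move=> /fin_suppP[s us xs]; rewrite !(@pairing_seq _ _ s) // -big_split.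
by apply: eq_bigr => o _; rewrite mulrDr.
Qed.

Lemma pairingZr a x F : fin_supp x -> pairing x (fun o => a * F o) = a * pairing x F.
Proof.
move=> /fin_suppP[s us xs]; rewrite !(@pairing_seq _ _ s) // mulr_sumr.
by apply: eq_bigr => o _; rewrite mulrCA.
Qed.

Lemma pairing0l F : pairing (fun=> 0) F = 0.
Proof. by rewrite (@pairing_seq _ _ [::]) // big_nil. Qed.

Lemma pairing0r x : pairing x (fun=> 0) = 0.
Proof. by apply: fsbig1 => o _; rewrite mulr0. Qed.

Lemma pairing_delta o F : pairing (delta o) F = F o.
Proof.
rewrite (@pairing_seq _ _ [:: o]) //; first by rewrite big_seq1 /delta eqxx mul1r.
by move=> o'; rewrite inE /delta => /negbTE->.
Qed.

Lemma pairing_norm_le x F M : fin_supp x -> (forall o, x o != 0 -> `|F o| <= M) ->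
  `|pairing x F| <= l1norm x * M.
Proof.
move=> /fin_suppP[s us xs] FM; rewrite (pairing_seq _ us xs) (l1norm_seq us xs).
rewrite mulr_suml (le_trans (ler_norm_sum _ _ _)) // ler_sum // => o _.
rewrite normrM; have [->|/FM] := eqVneq (x o) 0; first by rewrite normr0 !mul0r.
by move=> h; rewrite ler_wpM2l.
Qed.

Lemma l1norm0 : l1norm (fun _ : O => 0 : rat) = 0.
Proof. by rewrite (@l1norm_seq _ [::]) // big_nil. Qed.

Lemma l1norm_delta o : l1norm (delta o) = 1.
Proof.
rewrite (@l1norm_seq _ [:: o]) //; first by rewrite big_seq1 /delta eqxx normr1.
by move=> o'; rewrite inE /delta => /negbTE->.
Qed.

Lemma l1normD x y : fin_supp x -> fin_supp y ->
  l1norm (fun o => x o + y o) <= l1norm x + l1norm y.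
Proof.
move=> fx fy; have [s [us xs ys]] := fin_supp2P fx fy.
rewrite !(@l1norm_seq _ s) // => [|o os]; last by rewrite xs // ys // addr0.
by rewrite -big_split; apply: ler_sum => o _; apply: ler_normD.
Qed.

Lemma l1normZ a x : fin_supp x -> l1norm (fun o => a * x o) = `|a| * l1norm x.
Proof.
move=> /fin_suppP[s us xs].
rewrite !(@l1norm_seq _ s) // => [|o os]; last by rewrite xs // mulr0.
by rewrite mulr_sumr; apply: eq_bigr => o _; rewrite normrM.
Qed.

Lemma fin_supp_reindex x (h : O -> O) : bijective h -> fin_supp x ->
  fin_supp (fun o => x (h o)).
Proof.
move=> [k kh hk] /fin_suppP[s us xs]; apply: (@fin_supp_subseq _ (map k s)) => o os.
by apply: xs; apply: contraNN os => ho; apply/mapP; exists (h o).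
Qed.

Lemma l1norm_reindex x (h : O -> O) : bijective h -> l1norm (fun o => x (h o)) = l1norm x.
Proof. by move=> bh; rewrite /l1norm [RHS](reindex_fsbigT h). Qed.

Lemma pairing_reindex x F (h k : O -> O) : cancel h k -> cancel k h ->
  pairing (fun o => x (h o)) F = pairing x (fun o => F (k o)).
Proof.
move=> hk kh; rewrite /pairing [RHS](reindex_fsbigT h); last by exists k.
by apply: eq_fsbigr => o _; rewrite hk.
Qed.

End Chains.

Section ChainMaps.
Local Open Scope ring_scope.
Variables (O1 O0 : choiceType) (D : O1 -> O0 -> rat).
Hypothesis finD : forall o, fin_supp (D o).

(** The coboundary is adjoint to the boundary: all sums run over finite supports and can be
    exchanged. *)
Lemma pairing_apply_map x F : fin_supp x ->
  pairing (apply_map D x) F = pairing x (fun o => pairing (D o) F).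
Proof.
move=> fx; have /fin_suppP[s us xs] := fx.
have /choice[t tP] : forall o, exists t : seq O0, forall o', o' \notin t -> D o o' = 0.
  by move=> o; have /fin_suppP[t _ tD] := finD o; exists t.
pose r := undup (flatten [seq t o | o <- s]).
have rD o o' : o \in s -> o' \notin r -> D o o' = 0.
  move=> os; rewrite mem_undup => o'r; apply: tP; apply: contraNN o'r => o't.
  by apply/flattenP; exists (t o) => //; apply: map_f.
have E o' : apply_map D x o' = \sum_(o <- s) x o * D o o'.
  exact: (pairing_seq _ us xs).
rewrite (@pairing_seq _ _ _ r) ?undup_uniq // => [|o' o'r]; last first.
  by rewrite E big_seq big1 // => o os; rewrite rD // mulr0.
rewrite (pairing_seq _ us xs).
under eq_bigr do rewrite E mulr_suml.
rewrite exchange_big /= big_seq [RHS]big_seq; apply: eq_bigr => o os.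
rewrite (@pairing_seq _ _ _ r) ?undup_uniq // => [|o' o'r]; last exact: rD.
by rewrite mulr_sumr; apply: eq_bigr => o' _; rewrite mulrA.
Qed.

Lemma apply_mapD x y : fin_supp x -> fin_supp y ->
  apply_map D (fun o => x o + y o) = (fun o => apply_map D x o + apply_map D y o).
Proof. by move=> fx fy; apply/funext => o'; apply: pairingDl. Qed.

Lemma apply_mapZ a x : fin_supp x ->
  apply_map D (fun o => a * x o) = (fun o => a * apply_map D x o).
Proof. by move=> fx; apply/funext => o'; apply: pairingZl. Qed.

Lemma apply_map_delta o : apply_map D (delta o) = D o.
Proof. by apply/funext => o'; apply: pairing_delta. Qed.

Lemma apply_map0 : apply_map D (fun=> 0) = (fun=> 0).
Proof. by apply/funext => o'; apply: pairing0l. Qed.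

End ChainMaps.

(** * Transporting integrals to a permutation resolution *)

Lemma rat_nat_bound (q : rat) : exists n : nat, (q <= n%:R)%R.
Proof.
exists (Num.bound `|q|%R).
by apply: le_trans (ler_norm q) _; apply: ltW; apply: archi_boundP.
Qed.

Section CoarseMaps.
Local Open Scope ring_scope.
Variables (T : topologicalType) (mul : T -> T -> T) (inv : T -> T) (one : T).
Hypothesis tdlc : is_tdlc_group mul inv one.
Variables (V : Type) (act : T -> V -> V) (d : V -> V -> nat).
Hypothesis ca : ca_metric mul one act d.

Let actP := ca_action ca.
Let gm := ca_metricP ca.
Let dI := ca_invariant ca.

(** A bounded error is allowed because the stabilizer of a point of [O] may fix no vertex. *)
Definition coarsely_equivariant (O : choiceType) (actO : T -> O -> O) (b : O -> V) (M : nat) :=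
  forall g o, (d (b (actO g o)) (act g (b o)) <= M)%N.

(** Write each point as g t with t among finitely many representatives and send it to g v0.
    Different choices of g differ by elements carrying one representative to another; these form a
    compact set and move v0 boundedly. *)
Lemma coarse_map (O : choiceType) (actO : T -> O -> O) (v0 : V) :
  proper_fin_Gset mul one actO -> exists b M, coarsely_equivariant actO b M.
Proof.
move=> [actOP [stb [s sP]]].
have /choice[c cP] : forall o, exists p : T * O, p.2 \in s /\ o = actO p.1 p.2.
  by move=> o; have [g [t [ts ->]]] := sP o; exists (g, t).
have [|||M HM] := @finite_set_nat_bound _ [set p | p \in [seq (t, t') | t <- s, t' <- s]]
    (fun p M => forall h, actO h p.1 = p.2 -> (d v0 (act h v0) <= M)%N).
- exact: finite_seq.
- by move=> p m n mn pm h /pm /leq_trans; apply.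
- move=> [t t'] _; have [ct _] := stb t.
  have [n Hn] := ca_compact_bound tdlc v0 ca (compact_transporter tdlc actOP (w := t') ct).
  by exists n => h /= ht; apply: Hn.
exists (fun o => act (c o).1 v0), M => g o.
have [ts oE] := cP o; have [ts' goE] := cP (actO g o).
pose h := mul (inv (mul g (c o).1)) (c (actO g o)).1.
have <- : d v0 (act h v0) = d (act (c (actO g o)).1 v0) (act g (act (c o).1 v0)).
  by rewrite -(dI (mul g (c o).1)) -(actM actP _ h) (tg_mulKV tdlc) (actM actP) (gm_sym gm).
apply: (HM ((c (actO g o)).2, (c o).2)).
  by apply/allpairsP; exists ((c (actO g o)).2, (c o).2).
have E : actO g o = actO (mul g (c o).1) (c o).2 by rewrite (actM actOP) -oE.
by rewrite /h /= (actM actOP) -goE E (actVK tdlc actOP).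
Qed.

(** The coarse map is redefined on the image of [j] as the inverse of [j]; as this image is
    invariant, the error bound survives. *)
Lemma coarse_retraction (O : choiceType) (actO : T -> O -> O) (v0 : V) (j : V -> O) :
  proper_fin_Gset mul one actO -> injective j ->
  (forall g v, j (act g v) = actO g (j v)) ->
  exists b M, coarsely_equivariant actO b M /\ forall v, b (j v) = v.
Proof.
move=> PO ji je; have [actOP _] := PO; have [b [M bM]] := coarse_map v0 PO.
have /choice[b' bP] : forall o, exists v, (exists u, j u = o) /\ j v = o \/
    ~ (exists u, j u = o) /\ v = b o.
  move=> o; case: (pselect (exists u, j u = o)) => [[u uo]|no].
    by exists u; left; split=> //; exists u.
  by exists (b o); right.
have bj v : b' (j v) = v.
  by case: (bP (j v)) => [[_ /ji]|[no _]] //; case: no; exists v.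
exists b', M; split=> // g o; case: (bP o) => [[[u <-] _]|[no ->]].
  by rewrite -je !bj (gm_refl gm).
case: (bP (actO g o)) => [[[u uE] _]|[_ ->]]; last exact: bM.
by case: no; exists (act (inv g) u); rewrite je uE (actVK tdlc actOP).
Qed.

(** The bound is clear for finitely many representatives, whose images have finite support;
    translating adds the two errors of equivariance. *)
Lemma coarse_support (O' O : choiceType) (act' : T -> O' -> O') (actO : T -> O -> O)
    (D : O' -> O -> rat) b' b M' M :
  proper_fin_Gset mul one act' -> is_action mul one actO -> Gmap act' actO D ->
  coarsely_equivariant act' b' M' -> coarsely_equivariant actO b M ->
  exists N, forall o' o, D o' o != 0 -> (d (b' o') (b o) <= N)%N.
Proof.
move=> [act'P [_ [s sP]]] actOP [finD eqD] cb' cb.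
have [|||N HN] := @finite_set_nat_bound _ [set` s]
    (fun t N => forall q, D t q != 0 -> (d (b' t) (b q) <= N)%N).
- exact: finite_seq.
- by move=> p m n mn pm h /pm /leq_trans; apply.
- move=> t _; have [||N HN] := @finite_set_nat_bound _ _ (fun q N => (d (b' t) (b q) <= N)%N) (finD t).
  + by move=> p m n mn /leq_trans; apply.
  + by move=> q _; exists (d (b' t) (b q)).
  by exists N.
exists (M' + N + M)%N => o' q; have [g [t [ts ->]]] := sP o'.
rewrite -[q](actKV tdlc actOP g) eqD => /(HN t ts) le.
have := cb' g t; have := cb g (actO (inv g) q).
have := gm_tri gm (b' (act' g t)) (act g (b' t)) (b (actO g (actO (inv g) q))).
have := gm_tri gm (act g (b' t)) (act g (b (actO (inv g) q))) (b (actO g (actO (inv g) q))).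
rewrite dI (gm_sym gm (act g (b _)) (b _)); lia.
Qed.

Lemma Gmap_norm_bound (O' O : choiceType) (act' : T -> O' -> O') (actO : T -> O -> O)
    (D : O' -> O -> rat) :
  proper_fin_Gset mul one act' -> is_action mul one actO -> Gmap act' actO D ->
  exists N : nat, forall o', l1norm (D o') <= N%:R.
Proof.
move=> [act'P [_ [s sP]]] actOP [finD eqD].
have [|||N HN] := @finite_set_nat_bound _ [set` s] (fun t N => l1norm (D t) <= N%:R).
- exact: finite_seq.
- by move=> p m n mn /le_trans; apply; rewrite ler_nat.
- by move=> t _; apply: rat_nat_bound.
exists N => o'; have [g [t [ts ->]]] := sP o'.
apply: le_trans (HN t ts); rewrite -(@l1norm_reindex _ (D (act' g t)) (actO g)).
  by rewrite (_ : (fun o => _) = D t) //; apply/funext => o; rewrite eqD.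
by exists (actO (inv g)) => o; rewrite ?(actVK tdlc actOP) ?(actKV tdlc actOP).
Qed.

Lemma invariant_bound (O : choiceType) (actO : T -> O -> O) (eps : O -> rat) :
  proper_fin_Gset mul one actO -> (forall g o, eps (actO g o) = eps o) ->
  exists N : nat, forall o, `|eps o| <= N%:R.
Proof.
move=> [_ [_ [s sP]]] inve.
have [|||N HN] := @finite_set_nat_bound _ [set` s] (fun t N => `|eps t| <= N%:R).
- exact: finite_seq.
- by move=> p m n mn /le_trans; apply; rewrite ler_nat.
- by move=> t _; apply: rat_nat_bound.
by exists N => o; have [g [t [ts ->]]] := sP o; rewrite inve; apply: HN.
Qed.

End CoarseMaps.

(** * From the isoperimetric inequality to linear bounds on integrals *)

Section IsoperimetricIntegral.
Local Open Scope ring_scope.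
Variables (T : topologicalType) (mul : T -> T -> T) (inv : T -> T) (one : T).
Hypothesis tdlc : is_tdlc_group mul inv one.
Variables (V : Type) (act : T -> V -> V) (d : V -> V -> nat).
Hypothesis ca : ca_metric mul one act d.
Variables (O0 O1 O2 : choiceType) (act0 : T -> O0 -> O0) (act1 : T -> O1 -> O1)
  (act2 : T -> O2 -> O2) (eps : O0 -> rat) (D1 : O1 -> O0 -> rat) (D2 : O2 -> O1 -> rat).
Hypotheses (P0 : proper_fin_Gset mul one act0) (P1 : proper_fin_Gset mul one act1)
  (P2 : proper_fin_Gset mul one act2).
Hypothesis eps_inv : forall g o, eps (act0 g o) = eps o.
Hypotheses (GD1 : Gmap act1 act0 D1) (GD2 : Gmap act2 act1 D2).
Hypothesis exact0 : forall x : O0 -> rat, fin_supp x ->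
  (pairing x eps = 0 <-> exists y, fin_supp y /\ apply_map D1 y = x).
Hypothesis exact1 : forall x : O1 -> rat, fin_supp x ->
  (apply_map D1 x = (fun _ => 0) <-> exists y, fin_supp y /\ apply_map D2 y = x).
Variable C : rat.
Hypothesis C0 : 0 < C.
Hypothesis isop : forall x : O1 -> rat, fin_supp x -> apply_map D1 x = (fun _ => 0) ->
  forall e : rat, 0 < e ->
  exists y, fin_supp y /\ apply_map D2 y = x /\ l1norm y <= C * l1norm x + e.
Variables (j : V -> O0) (v0 : V).
Hypothesis j_inj : injective j.
Hypothesis j_act : forall g v, j (act g v) = act0 g (j v).
Hypothesis eps_v0 : eps (j v0) != 0.

Let actP := ca_action ca.
Let gm := ca_metricP ca.
Let finD1 := GD1.1.
Let finD2 := GD2.1.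

Definition edge_boundary (u v : V) : O0 -> rat := fun o => delta (j v) o + (-1) * delta (j u) o.

Lemma fin_supp_bd u v : fin_supp (edge_boundary u v).
Proof. by apply: fin_suppD; [|apply: fin_suppZ]; apply: fin_supp_delta. Qed.

Lemma pairing_bd u v F : pairing (edge_boundary u v) F = F (j v) - F (j u).
Proof.
have fd w := fin_supp_delta (j w).
rewrite (pairingDl F (fd v) (fin_suppZ (-1) (fd u))) (pairingZl (-1) F (fd u)).
by rewrite !pairing_delta mulN1r.
Qed.

Lemma eps_j v : eps (j v) = eps (j v0).
Proof. by have [g <-] := ca_transitive ca v0 v; rewrite j_act eps_inv. Qed.

(** All vertices have the same augmentation, so exactness fills every edge boundary. Transitivity
    leaves the finitely many edges at [v0], whose fillings are translated with unchanged norm. *)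
Lemma edge_filling b1 M : coarsely_equivariant act d act1 b1 M ->
  exists B R : nat, forall u v, (d u v <= 1)%N -> exists y,
  [/\ fin_supp y, apply_map D1 y = edge_boundary u v, l1norm y <= B%:R &
      forall o, y o != 0 -> (d u (b1 o) <= R)%N].
Proof.
move=> cb1.
have [||N HN] := @finite_set_nat_bound _ _ (fun v N => exists y,
    [/\ fin_supp y, apply_map D1 y = edge_boundary v0 v, l1norm y <= N%:R &
      forall o, y o != 0 -> (d v0 (b1 o) <= N)%N]) (ca_ball ca v0 1).
- move=> v m n mn [y [fy ey ly dy]]; exists y; split=> //.
    by apply: le_trans ly _; rewrite ler_nat.
  by move=> o /dy /leq_trans; apply.
- move=> v _.
  have [y [fy ey]] : exists y, fin_supp y /\ apply_map D1 y = edge_boundary v0 v.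
    by apply/exact0; [apply: fin_supp_bd | rewrite pairing_bd eps_j subrr].
  have [N1 HN1] := rat_nat_bound (l1norm y).
  have [||N2 HN2] := @finite_set_nat_bound _ _ (fun o N => (d v0 (b1 o) <= N)%N) fy.
  + by move=> p m n mn /leq_trans; apply.
  + by move=> o _; exists (d v0 (b1 o)).
  exists (N1 + N2)%N, y; split=> //.
    by apply: le_trans HN1 _; rewrite ler_nat leq_addr.
  by move=> o /HN2 /leq_trans; apply; rewrite leq_addl.
exists N, (N + M)%N => u v duv; have [g gu] := ca_transitive ca v0 u.
have [y [fy ey ly dy]] : exists y, [/\ fin_supp y,
    apply_map D1 y = edge_boundary v0 (act (inv g) v), l1norm y <= N%:R &
      forall o, y o != 0 -> (d v0 (b1 o) <= N)%N].
  by apply: HN => /=; rewrite -(ca_invariant ca g) gu (actKV tdlc actP).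
have [act1P _] := P1; have [act0P _] := P0.
have bij : bijective (act1 (inv g)).
  by exists (act1 g) => o; rewrite ?(actVK tdlc act1P) ?(actKV tdlc act1P).
exists (fun o => y (act1 (inv g) o)); split.
- exact: fin_supp_reindex.
- apply/funext => o; rewrite /apply_map -/(pairing _ (fun o1 => D1 o1 o)).
  rewrite (@pairing_reindex _ _ _ _ (act1 g)); last first.
  + by move=> o1; rewrite (actVK tdlc act1P).
  + by move=> o1; rewrite (actKV tdlc act1P).
  have -> : pairing y (fun o1 => D1 (act1 g o1) o) = apply_map D1 y (act0 (inv g) o).
    by apply: pairing_eq => o1 _; rewrite -[in LHS](actKV tdlc act0P g o) GD1.2.
  have eqg w : (act0 (inv g) o == w) = (o == act0 g w).
    by rewrite -(inj_eq (act_inj tdlc act0P (g := g))) (actKV tdlc act0P).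
  by rewrite ey /edge_boundary /delta !eqg -!j_act (actKV tdlc actP) gu.
- by rewrite l1norm_reindex.
- move=> q /dy le; rewrite -gu -[q](actKV tdlc act1P g).
  have := cb1 g (act1 (inv g) q).
  have := gm_tri gm (act g v0) (act g (b1 (act1 (inv g) q))) (b1 (act1 g (act1 (inv g) q))).
  rewrite (ca_invariant ca) (gm_sym gm (act g (b1 _))); lia.
Qed.

(* The 1-cochain phi dpsi, transported to Q[O1]: psi is extended to Q[O0] along
   b0, so that its coboundary is a sum over D1, and phi is evaluated at b1. *)
Definition potential (b0 : O0 -> V) (psi : V -> nat) (o : O0) : rat := eps o * (psi (b0 o))%:R.
Definition dpotential b0 psi (o1 : O1) : rat := pairing (D1 o1) (potential b0 psi).
Definition one_form (b0 : O0 -> V) (b1 : O1 -> V) (phi psi : V -> nat) (o1 : O1) : rat :=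
  (phi (b1 o1))%:R * dpotential b0 psi o1.

Lemma lipschitz_rat phi u v : lipschitz1 d phi ->
  `|(phi u)%:R - (phi v)%:R| <= (d u v)%:R :> rat.
Proof.
move=> lip; have := lip u v; have := lip v u; rewrite (gm_sym gm v u).
rewrite -!(ler_nat rat) !natrD => h1 h2; rewrite ler_norml; lra.
Qed.

Lemma D1D2 o2 : apply_map D1 (D2 o2) = (fun=> 0).
Proof.
apply/(exact1 (finD2 o2)); exists (delta o2).
by split; [apply: fin_supp_delta | rewrite apply_map_delta].
Qed.

Lemma eps_D1 o1 : pairing (D1 o1) eps = 0.
Proof.
apply/(exact0 (finD1 o1)); exists (delta o1).
by split; [apply: fin_supp_delta | rewrite apply_map_delta].
Qed.

Lemma pairing_form1 b0 psi y : fin_supp y ->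
  pairing y (dpotential b0 psi) = pairing (apply_map D1 y) (potential b0 psi).
Proof. by move=> fy; rewrite pairing_apply_map. Qed.

(** A walk is lifted edge by edge to a chain z on which the transported form is [eps (j v0)] times
    the walk integral, up to a linear error. If the walk is closed, z bounds some y of norm at most
    C|z| + 1, and the form is bounded on the boundary of each generator. *)
Lemma linear_integrals_of_isoperimetric : exists A, linear_integrals d A.
Proof.
have [act0P _] := P0; have [act1P _] := P1.
have [b0 [M0 [cb0 b0j]]] := coarse_retraction tdlc ca v0 P0 j_inj j_act.
have [b1 [M1 cb1]] := coarse_map tdlc ca v0 P1.
have [b2 [M2 cb2]] := coarse_map tdlc ca v0 P2.
have [R1 HR1] := coarse_support tdlc ca P1 act0P GD1 cb1 cb0.
have [R2 HR2] := coarse_support tdlc ca P2 act1P GD2 cb2 cb1.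
have [N1 HN1] := Gmap_norm_bound tdlc P1 act0P GD1.
have [N2 HN2] := Gmap_norm_bound tdlc P2 act1P GD2.
have [E0 HE0] := invariant_bound P0 eps_inv.
have [B [R HB]] := edge_filling cb1.
pose W : rat := N1%:R * (E0%:R * R1%:R).
have W0 : 0 <= W by rewrite !mulr_ge0.
(* [D1 o1] has augmentation 0, so psi may be shifted by [psi (b1 o1)], after which it is bounded on
   the support. *)
have formW psi o1 : lipschitz1 d psi -> `|dpotential b0 psi o1| <= W.
  move=> lip; have E : dpotential b0 psi o1 =
      pairing (D1 o1) (fun o => eps o * ((psi (b0 o))%:R - (psi (b1 o1))%:R)).
    rewrite -[RHS]addr0 -(mulr0 (psi (b1 o1))%:R) -(eps_D1 o1) -pairingZr //.
    by rewrite -pairingDr //; apply: pairing_eq => o _; rewrite /potential; ring.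
  rewrite E; apply: le_trans (@pairing_norm_le _ _ _ (E0%:R * R1%:R) (finD1 o1) _) _.
    move=> o Do; rewrite normrM ler_pM // (le_trans (lipschitz_rat _ _ lip)) // ler_nat.
    by rewrite (gm_sym gm); apply: HR1.
  by rewrite ler_wpM2r // mulr_ge0.
have shift phi psi (y : O1 -> rat) u (K : nat) : lipschitz1 d phi -> lipschitz1 d psi ->
    fin_supp y -> (forall o, y o != 0 -> (d u (b1 o) <= K)%N) ->
    `|pairing y (one_form b0 b1 phi psi) - (phi u)%:R * pairing (apply_map D1 y) (potential b0 psi)|
      <= l1norm y * (K%:R * W).
  move=> lphi lpsi fy yK; rewrite -pairing_form1 //.
  have -> : pairing y (one_form b0 b1 phi psi) - (phi u)%:R * pairing y (dpotential b0 psi) =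
      pairing y (fun o => ((phi (b1 o))%:R - (phi u)%:R) * dpotential b0 psi o).
    rewrite -mulNr -pairingZr // -pairingDr //.
    by apply: pairing_eq => o _; rewrite /one_form; ring.
  apply: pairing_norm_le => // o yo; rewrite normrM ler_pM //; last exact: formW.
  by rewrite (le_trans (lipschitz_rat _ _ lphi)) // ler_nat (gm_sym gm); apply: yK.
pose E : rat := B%:R * (R%:R * W).
have E_ge0 : 0 <= E by rewrite !mulr_ge0.
have pathP x s : path (nearby d) x s -> exists z, [/\ fin_supp z,
    apply_map D1 z = edge_boundary x (last x s), l1norm z <= B%:R * (size s)%:R &
    forall phi psi, lipschitz1 d phi -> lipschitz1 d psi ->
    `|pairing z (one_form b0 b1 phi psi) - eps (j v0) * (walk_integral phi psi x s)%:~R|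
      <= E * (size s)%:R].
  elim: s x => [|y s IHs] x /=.
    move=> _; exists (fun=> 0); split.
    - exact: fin_supp0.
    - by rewrite apply_map0; apply/funext => o; rewrite /edge_boundary mulN1r subrr.
    - by rewrite l1norm0 mulr0.
    - by move=> phi psi _ _; rewrite pairing0l mulr0 subr0 normr0 mulr0.
  move=> /andP[xy /IHs[z [fz ez lz wz]]].
  have [t [ft et lt dt]] := HB x y xy.
  exists (fun o => t o + z o); split.
  - exact: fin_suppD.
  - rewrite apply_mapD // et ez; apply/funext => o; rewrite /edge_boundary; ring.
  - apply: le_trans (l1normD ft fz) _; rewrite -natr1 mulrDr mulr1 addrC; exact: lerD.
  - move=> phi psi lphi lpsi; rewrite pairingDl //.
    have := shift phi psi t x R lphi lpsi ft dt.
    rewrite et pairing_bd /potential !b0j !eps_j => h1.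
    have h2 := wz phi psi lphi lpsi.
    rewrite rmorphD rmorphM rmorphB /= -!pmulrn -natr1 (mulrDr E) mulr1.
    set I := (walk_integral _ _ _ _)%:~R in h2 *.
    have {}h1 := le_trans h1 (ler_wpM2r (mulr_ge0 (ler0n rat R) W0) lt).
    rewrite -/E in h1.
    move: h1 h2.
    set e := eps _; set p := (phi x)%:R; set a := (psi y)%:R; set c := (psi x)%:R.
    set P := pairing _ _; set Q := pairing _ _ => h1 h2.
    have -> : P + Q - e * (p * (a - c) + I) = (Q - e * I) + (P - p * (e * a - e * c)) by ring.
    by apply: le_trans (ler_normD _ _) _; apply: lerD.
pose F : rat := N2%:R * (R2%:R * W).
have F0 : 0 <= F by rewrite !mulr_ge0.
have fillP phi psi y : lipschitz1 d phi -> lipschitz1 d psi -> fin_supp y ->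
    `|pairing (apply_map D2 y) (one_form b0 b1 phi psi)| <= l1norm y * F.
  move=> lphi lpsi fy; rewrite pairing_apply_map //.
  apply: pairing_norm_le => // o2 _.
  have := shift phi psi (D2 o2) (b2 o2) R2 lphi lpsi (finD2 o2) (HR2 o2).
  rewrite D1D2 pairing0l mulr0 subr0 => /le_trans; apply.
  by rewrite ler_wpM2r // mulr_ge0.
have [A HA] := rat_nat_bound ((E + (C * B%:R + 1) * F) / `|eps (j v0)|).
exists A => x s phi psi lphi lpsi ps ls.
have [z [fz ez lz wz]] := pathP x s ps.
have {}ez : apply_map D1 z = (fun=> 0).
  by rewrite ez ls; apply/funext => o; rewrite /edge_boundary mulN1r subrr.
(* The empty walk is set apart: for length at least 1 the slack 1 in the norm of y is absorbed into
   the linear bound. *)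
case: s => [|s0 s'] in ps ls lz wz *; first by rewrite /= normr0 muln0.
set s := s0 :: s' in ps ls lz wz *.
have [y [fy [ey ly]]] := isop fz ez ltr01.
have := fillP phi psi y lphi lpsi fy; rewrite ey => h1.
have h2 := wz phi psi lphi lpsi.
rewrite -(ler_int rat) intr_norm -pmulrn natrM.
set I := (walk_integral _ _ _ _)%:~R in h2 *.
set n : rat := (size s)%:R in lz h2 *.
have n1 : 1 <= n by rewrite /n ler1n.
have e0 : 0 < `|eps (j v0)| by rewrite normr_gt0.
have : `|eps (j v0)| * `|I| <= (E + (C * B%:R + 1) * F) * n.
  rewrite -normrM.
  have -> : eps (j v0) * I = pairing z (one_form b0 b1 phi psi)
     - (pairing z (one_form b0 b1 phi psi) - eps (j v0) * I) by ring.
  apply: le_trans (ler_normB _ _) _; rewrite mulrDl addrC lerD //.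
  apply: le_trans h1 _; rewrite [leRHS]mulrAC ler_wpM2r //.
  apply: le_trans ly _; rewrite mulrDl mul1r lerD // -mulrA ler_wpM2l //.
  exact: ltW.
rewrite ler_pdivrMr // in HA.
move=> h; rewrite -(ler_pM2l e0); apply: le_trans h _.
by rewrite [leRHS]mulrCA [leRHS]mulrA ler_wpM2r ?ler0n.
Qed.

End IsoperimetricIntegral.

(** The Cayley-Abels graph is built on an orbit in [O0] itself, so its vertices are 0-chains of the
    given resolution and inclusion serves as [j]. *)
Lemma hyperbolic_of_isoperimetric (T : topologicalType) (mul : T -> T -> T) (inv : T -> T) (one : T) :
  is_tdlc_group mul inv one -> compactly_generated mul inv one ->
  weak_linear_isoperimetric mul one -> hyperbolic_group mul inv one.
Proof.
move=> tdlc cg [ O0 [ O1 [ O2 [act0 [actO1 [actO2 [eps [D1 [D2 H]]]]]]]]].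
case: H => P0 [P1 [P2 [eps_inv [GD1 [GD2 [surj [exact0 [exact1 [C [C0 isop]]]]]]]]]].
split=> //.
(* The augmentation is onto, hence not identically 0. *)
have [ o0 eps0] : exists o, eps o != 0%R.
  apply: contrapT => no; have [x [_ /esym/eqP]] := surj 1%R.
  rewrite fsbig1 ?oner_eq0 // => o _.
  have [->|e0] := eqVneq (eps o) 0%R; first by rewrite mulr0.
  by case: no; exists o.
have [act0P [stb _]] := P0.
pose V := {o : O0 | `[< exists g, o = act0 g o0 >]}.
have sub g (v : V) : `[< exists h, act0 g (val v) = act0 h o0 >].
  apply/asboolP; have /asboolP[h ->] := valP v.
  by exists (mul g h); rewrite (actM act0P).
pose act g (v : V) : V := exist _ (act0 g (val v)) (sub g v).
have actP : is_action mul one act.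
  split=> [v|g h v]; apply: val_inj => /=; first exact: (act1 act0P).
  exact: (actM act0P).
have v0P : `[< exists g, o0 = act0 g o0 >].
  by apply/asboolP; exists one; rewrite (act1 act0P).
pose v0 : V := exist _ o0 v0P.
have tr v : exists g, act g v0 = v.
  by have /asboolP[g gE] := valP v; exists g; apply: val_inj.
have stabE v : stab act v = stab act0 (val v).
  by apply/seteqP; split=> g /=; [move/(congr1 val) | move=> e; apply: val_inj].
have stbV v : compact (stab act v) /\ open (stab act v) by rewrite stabE.
have [adj cag] := cayley_abels_exists tdlc cg actP tr stbV.
exists V, adj, act; split=> //.
have [d ca ->] := cayley_abels_metric tdlc cag.
have [A linA] := @linear_integrals_of_isoperimetric _ _ _ _ tdlc _ _ _ ca _ _ _
  _ _ _ _ _ _ P0 P1 P2 eps_inv GD1 GD2 exact0 exact1 _ C0 isop val v0 val_inj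
  (fun g v => erefl) eps0.
exists (180 * A + 1).
exact: (four_point_of_linear_integrals (ca_metricP ca) linA).
Qed.

(** * Compact presentations *)

Section Presentation.
Variables (T : topologicalType) (mul : T -> T -> T) (inv : T -> T) (one : T).
Hypothesis tdlc : is_tdlc_group mul inv one.

Notation eval := (eval_word mul inv one).

Lemma eval_word_cat u v : eval (u ++ v) = mul (eval u) (eval v).
Proof.
by elim: u => [|l u IHu] /=; [rewrite (tg_mul1 tdlc) | rewrite IHu (tg_mulA tdlc)].
Qed.

Definition letter_inv (l : bool * T) : bool * T := (~~ l.1, l.2).
Definition word_inv (w : seq (bool * T)) : seq (bool * T) := rev (map letter_inv w).

Lemma letter_val_inv l : letter_val inv (letter_inv l) = inv (letter_val inv l).
Proof. by case: l => -[] g; rewrite /letter_val /= ?(tg_invK tdlc). Qed.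

Lemma eval_word_inv w : eval (word_inv w) = inv (eval w).
Proof.
elim: w => [|l w IHw]; first by rewrite /= (tg_inv1 tdlc).
rewrite /word_inv /= rev_cons -cats1 eval_word_cat IHw /= letter_val_inv.
by rewrite (tg_mulr1 tdlc) (tg_invM tdlc).
Qed.

Lemma word_over_cat (K : set T) u v : word_over K (u ++ v) <-> word_over K u /\ word_over K v.
Proof.
split=> [h|[hu hv] l]; last by rewrite mem_cat => /orP[/hu|/hv].
by split=> l lu; apply: h; rewrite mem_cat lu ?orbT.
Qed.

Lemma word_over_inv (K : set T) w : word_over K w -> word_over K (word_inv w).
Proof. by move=> Kw l; rewrite mem_rev => /mapP[m /Kw ? ->]. Qed.

Variables (K : set T) (R : set (seq (bool * T))).
Notation equiv := (clos_refl_sym_trans _ (pres_step K R)).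

Lemma pres_step_cat a b w w' : pres_step K R w w' -> pres_step K R (a ++ w ++ b) (a ++ w' ++ b).
Proof.
move=> [[u [v [l [Kl [-> ->]]]]]|[u [v [r [Rr [-> ->]]]]]].
  by left; exists (a ++ u), (v ++ b), l; rewrite -!catA.
by right; exists (a ++ u), (v ++ b), r; rewrite -!catA.
Qed.

Lemma pres_equiv_cat a b w w' : equiv w w' -> equiv (a ++ w ++ b) (a ++ w' ++ b).
Proof.
elim=> [x y xy|x|x y _ IH|x y z _ IH1 _ IH2].
- exact/rst_step/pres_step_cat.
- exact: rst_refl.
- exact: rst_sym.
- exact: rst_trans IH1 IH2.
Qed.

Lemma word_inv_cancel w : word_over K w -> equiv (word_inv w ++ w) [::].
Proof.
elim: w => [|l w IHw] Kw; first exact: rst_refl.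
have Kl : K l.2 by apply: Kw; rewrite inE eqxx.
apply: rst_trans (IHw _); last by move=> m mw; apply: Kw; rewrite inE mw orbT.
apply: rst_step; left; exists (word_inv w), w, (letter_inv l); split=> //; split=> //.
rewrite /word_inv /= rev_cons -cats1 -catA /= /letter_inv /= negbK.
by case: l {Kw Kl}.
Qed.

(** Insert the inverse of [s'] followed by [s'] after [s], then delete the relator formed by [s] and
    that inverse. *)
Lemma pres_equiv_replace a b s s' : word_over K s' -> R (s ++ word_inv s') ->
  equiv (a ++ s ++ b) (a ++ s' ++ b).
Proof.
move=> Ks' Rs; apply: pres_equiv_cat.
apply: (@rst_trans _ _ _ (s ++ (word_inv s' ++ s') ++ [::])).
  apply: rst_sym; have := pres_equiv_cat s [::] (word_inv_cancel Ks').
  by rewrite !cats0.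
apply: rst_step; right; exists [::], s', (s ++ word_inv s'); split=> //.
by rewrite cats0 catA.
Qed.

End Presentation.

(** * A compact presentation from the four-point condition *)

Section HyperbolicPresentation.
Variables (T : topologicalType) (mul : T -> T -> T) (inv : T -> T) (one : T).
Hypothesis tdlc : is_tdlc_group mul inv one.
Variables (V : Type) (act : T -> V -> V) (d : V -> V -> nat).
Hypothesis ca : ca_metric mul one act d.
Variable v0 : V.

Let actP := ca_action ca.
Let gm := ca_metricP ca.
Let dI := ca_invariant ca.
Notation eval := (eval_word mul inv one).

Definition unit_gens : set T := [set g | d v0 (act g v0) <= 1].

Lemma unit_gens_compact : compact unit_gens.
Proof.
have /(@finite_seqP {classic V})[s sE] := ca_ball ca v0 1.
have -> : unit_gens = \bigcup_(u in [set x : {classic V} | x \in s]) [set h | act h v0 = u].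
  apply/seteqP; split=> [g /= Kg|g [u us /= gu]].
    exists (act g v0) => //=.
    by have : [set u | d v0 u <= 1] (act g v0) by []; rewrite sE.
  by rewrite /unit_gens /= gu; have : [set u | d v0 u <= 1] u by rewrite sE.
rewrite bigcup_seq; apply: bigsetU_compact => u _.
by apply: (compact_transporter tdlc actP); have [] := ca_stab ca v0.
Qed.

Lemma unit_gens_letter (l : bool * T) : unit_gens l.2 -> unit_gens (letter_val inv l).
Proof.
rewrite /letter_val; case: l.1 => //.
by rewrite /unit_gens /= => Kl; rewrite -(dI l.2) (actKV tdlc actP) (gm_sym gm).
Qed.

(** Letters are split off along a geodesic from [v0] to g v0. [n] must be positive, since a
    nontrivial element fixing [v0] still takes one letter. *)
Lemma short_word n g : 0 < n -> d v0 (act g v0) <= n ->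
  exists w, [/\ word_over unit_gens w, eval w = g & size w <= n].
Proof.
elim: n g => // -[|n] IHn g _ dg.
  exists [:: (false, g)]; split=> //=; last by rewrite (tg_mulr1 tdlc).
  by move=> l; rewrite inE => /eqP->.
have [q [dq dqg]] : exists q, d v0 q <= n.+1 /\ d q (act g v0) <= 1.
  have [f [f0 fn fd]] := gm_geod gm v0 (act g v0).
  (* For distance 0 the truncated predecessor is 0, and the chosen vertex is [v0] itself. *)
  exists (f (d v0 (act g v0)).-1).
  set m := d v0 (act g v0) in dg fn fd *.
  have := fd 0 m.-1 ltac:(lia); have := fd m.-1 m ltac:(lia); rewrite f0 fn; lia.
have [h hq] := ca_transitive ca v0 q.
have [|w [Kw wh sw]] := IHn h isT; first by rewrite hq.
exists (w ++ [:: (false, mul (inv h) g)]); split.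
- apply/word_over_cat; split=> // l; rewrite inE => /eqP-> /=.
  by rewrite /unit_gens /= -(dI h) -(actM actP) (tg_mulKV tdlc) hq.
- by rewrite (eval_word_cat tdlc) wh /= (tg_mulr1 tdlc) (tg_mulKV tdlc).
- by rewrite size_cat /= addn1.
Qed.

(** The relators are all trivial words of length at most 4k. The prefixes of a longer trivial word
    trace a closed walk, whose shortcut replaces a subword of length 2k by one of length at most 2k
    - 1; the two subwords together form a relator. *)
Lemma compactly_presented_of_four_point delta :
  four_point d delta -> compactly_presented mul inv one.
Proof.
move=> fp; pose k := (2 * delta).+1.
pose R := [set r | word_over unit_gens r /\ eval r = one /\ size r <= 2 * (k + k)].
exists unit_gens, R, (2 * (k + k)); split; first exact: unit_gens_compact.
split.
  move=> g; have [w [Kw wg _]] := @short_word (d v0 (act g v0)).+1 g isT (leqnSn _).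
  by exists w.
split=> // w; have [n] := ubnP (size w); elim: n w => // n IHn w sw Kw ew.
have [le|gt] := leqP (size w) (2 * (k + k)).
  apply: rst_step; right; exists [::], [::], w; split; first by [].
  by rewrite cats0.
pose f i := act (eval (take i w)) v0.
have [|||i ile di] := @four_point_shortcut _ _ gm delta k (size w) f fp (ltnSn _).
- lia.
- by rewrite /f take0 take_size ew.
- move=> i iw; rewrite /f (take_nth (false, one) iw) -cats1 (eval_word_cat tdlc).
  rewrite (actM actP) dI /= (tg_mulr1 tdlc); apply: unit_gens_letter.
  by apply: Kw; apply: mem_nth.
pose a := take i w; pose s := take (k + k) (drop i w); pose b := drop (i + (k + k)) w.
have wE : w = a ++ s ++ b.
  by rewrite /a /s /b addnC -drop_drop cat_take_drop cat_take_drop.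
have as_ : take (i + (k + k)) w = a ++ s by rewrite takeD.
have ds : d v0 (act (eval s) v0) <= (k + k).-1.
  by move: di; rewrite /f as_ (eval_word_cat tdlc) (actM actP) dI; lia.
have [Ka] := proj1 (word_over_cat _ _ _) (eq_ind _ (word_over unit_gens) Kw _ wE).
move=> /word_over_cat[Ks Kb].
have [|s' [Ks' es' ss']] := short_word _ ds; first by rewrite /k; lia.
have ss : size s <= k + k by rewrite /s size_take; case: ltnP => //; lia.
have sE : size s = k + k by rewrite /s size_takel // size_drop; lia.
have Rs : R (s ++ word_inv s').
  split; first by apply/word_over_cat; split=> //; apply: word_over_inv.
  split; first by rewrite (eval_word_cat tdlc) (eval_word_inv tdlc) es' (tg_mulrV tdlc).
  by rewrite size_cat size_rev size_map; lia.
rewrite wE; apply: rst_trans (pres_equiv_replace a b Ks' Rs) _.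
apply: IHn.
- by move: sw; rewrite {1}wE !size_cat; lia.
- by do 2 (apply/word_over_cat; split=> //).
- by rewrite -[RHS]ew [in RHS]wE !(eval_word_cat tdlc) es'.
Qed.

End HyperbolicPresentation.

(** * Filling cycles by short loops *)

Section EdgeWalks.
Variables (V : choiceType) (d : V -> V -> nat).
Hypothesis gm : geodesic_metric d.

(** Oriented edges, the degenerate ones (u, u) included. An edge and its reverse are separate basis
    elements of the 1-chains. *)
Definition edge : choiceType := {e : V * V | d e.1 e.2 <= 1}.
Definition source (e : edge) : V := (val e).1.
Definition target (e : edge) : V := (val e).2.

Lemma edge_dist e : d (source e) (target e) <= 1. Proof. exact: (valP e). Qed.

Lemma edge_rev_subproof (e : edge) : d (target e) (source e) <= 1.
Proof. by rewrite (gm_sym gm) edge_dist. Qed.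
Definition edge_rev (e : edge) : edge := exist _ (target e, source e) (edge_rev_subproof e).

Lemma edge_revK : involutive edge_rev.
Proof. by move=> e; apply: val_inj => /=; case: e => -[]. Qed.

Fixpoint ewalk (u : V) (c : seq edge) (v : V) : bool :=
  if c is e :: c' then (source e == u) && ewalk (target e) c' v else u == v.

Definition walk_end (u : V) (c : seq edge) : V := last u (map target c).

Lemma ewalk_end u c v : ewalk u c v -> v = walk_end u c.
Proof.
by elim: c u => [|e c IHc] u /=; [move/eqP | case/andP=> _ /IHc].
Qed.

Lemma ewalk_cat u a b v :
  ewalk u (a ++ b) v = ewalk u a (walk_end u a) && ewalk (walk_end u a) b v.
Proof.
by elim: a u => [|e a IHa] u /=; rewrite ?eqxx // IHa andbA.
Qed.

Lemma ewalk_trans u a v b w : ewalk u a v -> ewalk v b w -> ewalk u (a ++ b) w.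
Proof. by move=> ua vb; rewrite ewalk_cat -(ewalk_end ua) ua. Qed.

Definition rev_walk (c : seq edge) : seq edge := rev (map edge_rev c).

Lemma ewalk_rev u c v : ewalk u c v -> ewalk v (rev_walk c) u.
Proof.
elim: c u => [|e c IHc] u /=; first by rewrite eq_sym.
move=> /andP[/eqP <- /IHc wc]; rewrite /rev_walk /= rev_cons -cats1.
by apply: ewalk_trans wc _; rewrite /= !eqxx.
Qed.

Lemma ewalk_exists u v : exists2 c, ewalk u c v & size c = d u v.
Proof.
have [f [f0 fn fd]] := gm_geod gm u v.
suff H n i : i + n <= d u v -> exists2 c, ewalk (f i) c (f (i + n)) & size c = n.
  by have [c] := H (d u v) 0 (leqnn _); rewrite f0 fn; exists c.
elim: n i => [|n IHn] i le; first by exists [::] => //=; rewrite addn0.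
have [|c wc sc] := IHn i.+1; first lia.
have fi : d (f i) (f i.+1) <= 1 by rewrite fd; lia.
exists (exist _ (f i, f i.+1) fi :: c); last by rewrite /= sc.
by rewrite /= eqxx -addSnnS.
Qed.

(** The empty walk is excluded because its stabilizer, the whole group, need not be compact. *)
Definition closed_walk (c : seq edge) : bool :=
  if c is e :: _ then ewalk (source e) c (source e) else false.

Local Open Scope ring_scope.

Definition chain (c : seq edge) : edge -> rat := fun e => (count_mem e c)%:R.

Definition bd1 (e : edge) : V -> rat := fun v => delta (target e) v + (-1) * delta (source e) v.

Lemma fin_supp_bd1 e : fin_supp (bd1 e).
Proof. by apply: fin_suppD; [|apply: fin_suppZ]; apply: fin_supp_delta. Qed.

Lemma pairing_bd1 e F : pairing (bd1 e) F = F (target e) - F (source e).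
Proof.
have fd w := @fin_supp_delta V w.
rewrite (pairingDl F (fd _) (fin_suppZ (-1) (fd _))) (pairingZl (-1) F (fd _)).
by rewrite !pairing_delta mulN1r.
Qed.

Lemma chain_nil : chain [::] = (fun=> 0). Proof. by []. Qed.

Lemma chain_cons e c : chain (e :: c) = (fun e' => delta e e' + chain c e').
Proof. by apply/funext => e'; rewrite /chain /= natrD /delta eq_sym. Qed.

Lemma chain_cat a b : chain (a ++ b) = (fun e => chain a e + chain b e).
Proof. by apply/funext => e; rewrite /chain count_cat natrD. Qed.

Lemma fin_supp_chain c : fin_supp (chain c).
Proof.
elim: c => [|e c IHc]; first exact: fin_supp0.
by rewrite chain_cons; apply: fin_suppD IHc; apply: fin_supp_delta.
Qed.

Lemma pairing_chain c F : pairing (chain c) F = \sum_(e <- c) F e.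
Proof.
elim: c => [|e c IHc]; first by rewrite big_nil pairing0l.
rewrite chain_cons (pairingDl F (@fin_supp_delta _ e) (fin_supp_chain c)).
by rewrite pairing_delta big_cons IHc.
Qed.

Lemma bd1_chain u c v : ewalk u c v ->
  apply_map bd1 (chain c) = (fun w => delta v w + (-1) * delta u w).
Proof.
elim: c u => [|e c IHc] u /=.
  by move/eqP->; rewrite apply_map0; apply/funext => w; rewrite mulN1r subrr.
move=> /andP[/eqP <- /IHc {}IHc]; rewrite chain_cons.
rewrite (apply_mapD _ (@fin_supp_delta _ e) (fin_supp_chain c)) apply_map_delta IHc.
by apply/funext => w; rewrite /bd1; ring.
Qed.

(** A walk from [v0] to v has boundary v - v0, and a chain of augmentation 0 is a combination of
    such differences. *)
Lemma augmentation_exact (v0 : V) (x : V -> rat) : fin_supp x -> pairing x (fun=> 1) = 0 ->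
  exists y, fin_supp y /\ apply_map bd1 y = x.
Proof.
move=> /fin_suppP[s _ xs] x0.
(* The term at [v0] corrects the augmentation, which makes the claim hold for every [x] and allows
   induction on the support. *)
suff [y [fy ey]] : exists y, fin_supp y /\
    apply_map bd1 y = (fun v => x v + (- pairing x (fun=> 1)) * delta v0 v).
  exists y; split=> //; rewrite ey x0.
  by apply/funext => v; rewrite oppr0 mul0r addr0.
elim: s x xs {x0} => [|v s IHs] x xs.
  have -> : x = (fun=> 0) by apply/funext => v; apply: xs.
  exists (fun=> 0); split; first exact: fin_supp0.
  by rewrite apply_map0 pairing0l; apply/funext => v; rewrite oppr0 mul0r addr0.
have fx : fin_supp x by apply: fin_supp_subseq xs.
pose x1 w := x w + (- x v) * delta v w.
have fv := fin_suppZ (- x v) (@fin_supp_delta _ v).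
have [|y [fy ey]] := IHs x1.
  move=> w ws; rewrite /x1 /delta; have [->|nwv] := eqVneq w v.
    by rewrite mulr1 subrr.
  by rewrite mulr0 addr0 xs // inE negb_or nwv.
have [c wc _] := ewalk_exists v0 v.
have fc := fin_suppZ (x v) (fin_supp_chain c).
exists (fun e => y e + x v * chain c e); split; first exact: fin_suppD.
rewrite (apply_mapD _ fy fc) (apply_mapZ _ _ (fin_supp_chain c)) (bd1_chain wc) ey.
have -> : pairing x1 (fun=> 1) = pairing x (fun=> 1) - x v.
  rewrite /x1 (pairingDl _ fx fv) (pairingZl _ _ (@fin_supp_delta _ v)).
  by rewrite pairing_delta mulr1.
by apply/funext => w; rewrite /x1; ring.
Qed.

Section Filling.
Variable N : nat.

Definition short_loop : choiceType :=
  {c : seq edge | closed_walk c && (size c <= N)%N}.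

Definition bd2 (c : short_loop) : edge -> rat := chain (val c).

Definition fills (h : edge -> rat) (r : rat) : Prop :=
  exists y, [/\ fin_supp y, apply_map bd2 y = h & l1norm y <= r].

Lemma fin_supp_bd2 c : fin_supp (bd2 c). Proof. exact: fin_supp_chain. Qed.

Lemma fills0 : fills (fun=> 0) 0.
Proof. by exists (fun=> 0); split; rewrite ?apply_map0 ?l1norm0 //; exact: fin_supp0. Qed.

Lemma fillsD h h' r r' : fills h r -> fills h' r' -> fills (fun e => h e + h' e) (r + r').
Proof.
move=> [y [fy <- ly]] [y' [fy' <- ly']]; exists (fun o => y o + y' o); split.
- exact: fin_suppD.
- by rewrite apply_mapD.
- by apply: le_trans (l1normD fy fy') (lerD ly ly').
Qed.

Lemma fillsZ a h r : fills h r -> fills (fun e => a * h e) (`|a| * r).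
Proof.
move=> [y [fy <- ly]]; exists (fun o => a * y o); split.
- exact: fin_suppZ.
- by rewrite apply_mapZ.
- by rewrite l1normZ // ler_wpM2l.
Qed.

Lemma fills_le h r r' : r <= r' -> fills h r -> fills h r'.
Proof. by move=> rr [y [fy ey /le_trans ly]]; exists y; split=> //; apply: ly. Qed.

Lemma fills_short u c : ewalk u c u -> (size c <= N)%N -> fills (chain c) 1.
Proof.
case: c => [_ _|e c w s]; first exact: fills_le ler01 fills0.
have cP : closed_walk (e :: c) && (size (e :: c) <= N)%N.
  by rewrite s andbT; move: w; rewrite /= => /andP[/eqP <- ->]; rewrite eqxx.
exists (delta (exist _ (e :: c) cP : short_loop)); split.
- exact: fin_supp_delta.
- by rewrite apply_map_delta.
- by rewrite l1norm_delta.
Qed.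

End Filling.

Variables (dlt : nat).
Hypothesis fp : four_point d dlt.
Let k := (2 * dlt).+1.
Let N := (2 * (k + k))%N.

Lemma ewalk_step u c v i : ewalk u c v -> (i < size c)%N ->
  (d (walk_end u (take i c)) (walk_end u (take i.+1 c)) <= 1)%N.
Proof.
elim: c u i => // e c IHc u [|i] /=; last by move=> /andP[_ w]; apply: IHc w.
by move=> /andP[/eqP <- _] _; rewrite take0; apply: edge_dist.
Qed.

(** A shortcut replaces a piece s by s'. The chains of s and s' differ by those of the short loops s
    s'^-1 and s' s'^-1, the second of which cancels the reversed edges. Each replacement costs 2 and
    removes at least one edge. *)
Lemma fills_loop u c : ewalk u c u -> fills N (chain c) (2 * (size c)%:R).
Proof.
have [n] := ubnP (size c); elim: n c => // n IHn c sc wc.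
have [le|gt] := leqP (size c) N.
  case: c => [|e c] in sc wc le *.
    by rewrite chain_nil mulr0; apply: fills0.
  apply: fills_le (fills_short wc le).
  by rewrite -natrM ler1n.
pose f i := walk_end u (take i c).
have [|||i ile di] := @four_point_shortcut _ _ gm dlt k (size c) f fp (ltnSn _).
- by move: gt; rewrite /N; lia.
- by rewrite /f take0 take_size /= -(ewalk_end wc).
- by move=> i ic; apply: ewalk_step wc ic.
pose a := take i c; pose s := take (k + k) (drop i c); pose b := drop (i + (k + k)) c.
have cE : c = a ++ s ++ b.
  by rewrite /a /s /b addnC -drop_drop cat_take_drop cat_take_drop.
have as_ : take (i + (k + k)) c = a ++ s by rewrite takeD.
have sE : size s = (k + k)%N by rewrite /s size_takel // size_drop; lia.
move: di; rewrite /f as_ -/a.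
have [p pE] : exists p, p = walk_end u a by exists (walk_end u a).
have [q qE] : exists q, q = walk_end u (a ++ s) by exists (walk_end u (a ++ s)).
rewrite -pE -qE => dpq.
have [wa ws wb] : [/\ ewalk u a p, ewalk p s q & ewalk q b u].
  have e : walk_end p s = q by rewrite qE pE /walk_end map_cat last_cat.
  by move: wc; rewrite cE ewalk_cat -pE => /andP[-> ]; rewrite ewalk_cat e => /andP[-> ->].
have [s' ws' ss'] := ewalk_exists p q.
have l1 : ewalk p (s ++ rev_walk s') p by apply: ewalk_trans ws (ewalk_rev ws').
have l2 : ewalk p (s' ++ rev_walk s') p by apply: ewalk_trans ws' (ewalk_rev ws').
have l3 : ewalk u (a ++ s' ++ b) u by apply: ewalk_trans wa (ewalk_trans ws' wb).
have sr : size (rev_walk s') = size s' by rewrite size_rev size_map.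
have f1 : fills N (chain (s ++ rev_walk s')) 1.
  by apply: fills_short l1 _; rewrite size_cat sr sE ss' /N; lia.
have f2 : fills N (chain (s' ++ rev_walk s')) 1.
  by apply: fills_short l2 _; rewrite size_cat sr ss' /N; lia.
have sz : (size (a ++ s' ++ b) < size c)%N by rewrite [in ltnRHS]cE !size_cat ss' sE; lia.
have f3 := IHn _ (leq_trans sz sc) l3.
have := fillsD f3 (fillsD f1 (fillsZ (-1) f2)).
have -> : (fun e => chain (a ++ s' ++ b) e + (chain (s ++ rev_walk s') e +
    -1 * chain (s' ++ rev_walk s') e)) = chain c.
  by apply/funext => e; rewrite cE !chain_cat; ring.
apply: fills_le; rewrite normrN normr1 mulr1.
by move: sz; rewrite -(ler_nat rat) -natr1; lra.
Qed.

Lemma seq_min (x : edge -> rat) (c : seq edge) : c != [::] ->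
  exists2 e, e \in c & forall e', e' \in c -> x e <= x e'.
Proof.
elim: c => // e c IHc _; case: (eqVneq c [::]) => [->|/IHc[m mc mmin]].
  by exists e; rewrite ?inE // => e'; rewrite inE => /eqP->.
have [le|/ltW le] := leP (x e) (x m).
  exists e; first by rewrite inE eqxx.
  by move=> e'; rewrite inE => /orP[/eqP->//|/mmin]; apply: le_trans.
exists m; first by rewrite inE mc orbT.
by move=> e'; rewrite inE => /orP[/eqP->//|/mmin].
Qed.

Lemma l1norm_nonneg (x : edge -> rat) : (forall e, 0 <= x e) ->
  l1norm x = pairing x (fun=> 1).
Proof. by move=> x0; apply: eq_fsbigr => e _; rewrite ger0_norm // mulr1. Qed.

(* Following edges of the support of a nonnegative cycle never gets stuck, so
   the support contains a simple closed walk. *)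
Lemma cycle_support_loop (s : seq edge) :
  s != [::] -> (forall e, e \in s -> exists2 e', e' \in s & source e' = target e) ->
  exists u c, [/\ ewalk u c u, uniq c, c != [::] & {subset c <= s}].
Proof.
move=> s0 nxt; case: s s0 nxt => // e0 s' _; set s := e0 :: s' => nxt.
have /choice[f fP] : forall e, exists e', e \in s -> e' \in s /\ source e' = target e.
  move=> e; case: (boolP (e \in s)) => [/nxt[e' ? ?]|_]; first by exists e'.
  by exists e.
have it i : iter i f e0 \in s.
  by elim: i => [|i IHi] /=; [rewrite inE eqxx | case: (fP _ IHi)].
have exl : exists m, looping f e0 m.
  exists (size s); rewrite -[looping _ _ _]negbK -looping_uniq; apply/negP => us.
  have := @uniq_leq_size _ _ s us; rewrite size_traject ltnn => H.
  by suff: false by []; apply: H => e /trajectP[i _ ->].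
(* At the first repetition [m] the successor orbit returns to its entry [i]; the stretch from [i] to
   [m] is the simple loop. *)
case: (ex_minnP exl) => m lm mmin.
have um : uniq (traject f e0 m).
  case: m mmin lm => // m mmin _; rewrite looping_uniq; apply/negP => /mmin.
  by rewrite ltnn.
have /trajectP[i im iE] := lm.
pose y := iter i f e0.
have ty : iter (m - i) f y = y by rewrite /y -iterD subnK // ltnW.
have ys n : iter n f y \in s by rewrite /y -iterD.
exists (source y), (traject f y (m - i)); split.
- have H n z : (forall j, iter j f z \in s) ->
      ewalk (source z) (traject f z n) (source (iter n f z)).
    elim: n z => [|n IHn] z zs /=; rewrite ?eqxx //=.
    have [_ <-] := fP z (zs 0%N).
    by rewrite -iterS iterSr; apply: IHn => j; rewrite -iterSr.
  by have := H (m - i)%N y ys; rewrite ty.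
- move: um; have -> : m = (i + (m - i))%N by lia.
  by rewrite trajectD cat_uniq addKn => /and3P[].
- by rewrite -size_eq0 size_traject; lia.
- by move=> e /trajectP[j _ ->].
Qed.

(** Subtracting a simple loop of the support, scaled by its least coefficient, keeps a nonnegative
    cycle and removes an edge. The norm is additive on nonnegative chains, so the constant 2 does
    not grow. *)
Lemma fills_nonneg (x : edge -> rat) : fin_supp x -> (forall e, 0 <= x e) ->
  apply_map bd1 x = (fun=> 0) -> fills N x (2 * l1norm x).
Proof.
move=> /fin_suppP[s us xs].
have [n] := ubnP (size s); elim: n s us x xs => // n IHn s us x xs sn x0 dx.
have fx : fin_supp x by apply: fin_supp_subseq xs.
pose s1 := [seq e <- s | x e != 0].
have s1P e : (e \in s1) = (x e != 0).
  rewrite mem_filter andb_idr // => xe; apply/negPn/negP => /xs e0.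
  by rewrite e0 eqxx in xe.
have [s10|s10] := eqVneq s1 [::].
  have -> : x = (fun=> 0).
    by apply/funext => e; apply/eqP/negPn; rewrite -s1P s10.
  by rewrite l1norm0 mulr0; apply: fills0.
have [u [c [wc uc c0 cs]]] : exists u c,
    [/\ ewalk u c u, uniq c, c != [::] & {subset c <= s1}].
  (* If no edge of the support started at [target e], the boundary of [x] would be positive at that
     vertex. *)
  apply: cycle_support_loop => // e es.
  apply: contrapT => no.
  have hd e' : e' \in s1 -> source e' != target e.
    by move=> e's; apply/eqP => te; apply: no; exists e'.
  have := congr1 (fun h => h (target e)) dx; apply/eqP; rewrite gt_eqF //.
  have us1 : uniq s1 by rewrite filter_uniq.
  have xs1 e' : e' \notin s1 -> x e' = 0 by rewrite s1P negbK => /eqP.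
  rewrite /apply_map -/(pairing x (fun e' => bd1 e' (target e))) (pairing_seq _ us1 xs1).
  rewrite (bigD1_seq e) //= /bd1 {1}/delta eqxx {1}/delta eq_sym (negbTE (hd e es)).
  rewrite mulr0 addr0 mulr1; apply: ltr_pwDl.
    by rewrite lt_neqAle x0 eq_sym -s1P es.
  rewrite big_seq_cond; apply: sumr_ge0 => e' /andP[e's _].
  rewrite /delta [_ == source e']eq_sym (negbTE (hd e' e's)) mulr0 addr0.
  by rewrite mulr_ge0.
have [e1 e1c e1min] := seq_min x c0.
pose a := x e1; have a0 : 0 <= a by apply: x0.
pose x' e := x e + (- a) * chain c e.
have chainE e : chain c e = (e \in c)%:R by rewrite /chain count_uniq_mem.
have fc := fin_suppZ (- a) (fin_supp_chain c).
have x'0 e : 0 <= x' e.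
  rewrite /x' chainE; case: (boolP (e \in c)) => [/e1min le|_].
    by rewrite mulr1 subr_ge0.
  by rewrite mulr0 addr0.
have fx' : fills N x' (2 * l1norm x').
  apply: (IHn (rem e1 s1)) => //.
  - by rewrite rem_uniq // filter_uniq.
  - move=> e; rewrite mem_rem_uniq ?filter_uniq // !inE negb_and negbK.
    move=> /orP[/eqP->|es]; first by rewrite /x' chainE e1c mulr1 subrr.
    rewrite /x' chainE (_ : e \in c = false) ?mulr0 ?addr0.
      by move: es; rewrite s1P negbK => /eqP.
    by apply: contraNF es; apply: cs.
  - have e1s : e1 \in s1 by apply: cs.
    rewrite size_rem //.
    have : (0 < size s1)%N by case: (s1) e1s.
    by move: sn; rewrite /s1 size_filter; have := count_size (fun e => x e != 0) s; lia.
  - rewrite (apply_mapD _ fx fc) (apply_mapZ _ _ (fin_supp_chain c)) (bd1_chain wc) dx.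
    by apply/funext => v; rewrite mulN1r subrr mulr0 addr0.
have := fillsD fx' (fillsZ a (fills_loop wc)).
have -> : (fun e => x' e + a * chain c e) = x.
  by apply/funext => e; rewrite /x'; ring.
apply: fills_le; rewrite ger0_norm // !l1norm_nonneg //.
rewrite /x' (pairingDl _ fx fc) (pairingZl _ _ (fin_supp_chain c)) pairing_chain.
rewrite big_const_seq count_predT iter_addr addr0 -/(size c)%:R.
by rewrite le_eqVlt; apply/orP; left; apply/eqP; ring.
Qed.

(** Reversing edges negates the boundary, so z is a nonnegative cycle, and x = (x + z) - z is a
    difference of two such. As |z| <= 2|x|, the cost is at most 2(1 + 2)|x| + 4|x|. *)
Lemma fills_cycle (x : edge -> rat) : fin_supp x ->
  apply_map bd1 x = (fun=> 0) -> fills N x (10 * l1norm x).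
Proof.
move=> fx dx.
pose z e := `|x e| + `|x (edge_rev e)|.
have bij : bijective edge_rev by exists edge_rev; apply: edge_revK.
have fax : fin_supp (fun e => `|x e|).
  have /fin_suppP[s _ xs] := fx.
  by apply: (@fin_supp_subseq _ _ s) => e /xs->; rewrite normr0.
have faxr := fin_supp_reindex bij fax.
have fz : fin_supp z by apply: fin_suppD.
have lax : l1norm (fun e => `|x e|) = l1norm x.
  by apply: eq_fsbigr => e _; rewrite normr_id.
have lz : l1norm z <= 2 * l1norm x.
  apply: le_trans (l1normD fax faxr) _.
  by rewrite (@l1norm_reindex _ (fun e => `|x e|) _ bij) lax; lra.
have dz : apply_map bd1 z = (fun=> 0).
  rewrite (apply_mapD _ fax faxr); apply/funext => v.
  rewrite {2}/apply_map -/(pairing (fun e => `|x (edge_rev e)|) (fun e => bd1 e v)).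
  rewrite (@pairing_reindex _ (fun e => `|x e|) _ _ _ edge_revK edge_revK).
  have -> : pairing (fun e => `|x e|) (fun e => bd1 (edge_rev e) v) =
      (-1) * apply_map bd1 (fun e => `|x e|) v.
    rewrite -(pairingZr _ _ fax); apply: pairing_eq => e _.
    by rewrite /bd1 /=; ring.
  by rewrite mulN1r subrr.
have f1 : fills N z (2 * l1norm z) by apply: fills_nonneg => // e; rewrite addr_ge0.
have f2 : fills N (fun e => x e + z e) (2 * l1norm (fun e => x e + z e)).
  apply: fills_nonneg.
  - exact: fin_suppD.
  - move=> e; rewrite /z addrA addr_ge0 //.
    by have := ler_norm (- x e); rewrite normrN; lra.
  - by rewrite (apply_mapD _ fx fz) dx dz; apply/funext => v; rewrite addr0.
have := fillsD f2 (fillsZ (-1) f1).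
have -> : (fun e => x e + z e + -1 * z e) = x by apply/funext => e; ring.
apply: fills_le; have := l1normD fx fz; rewrite normrN normr1.
move: (l1norm _) (l1norm _) (l1norm _) lz => A B C' *; lra.
Qed.

End EdgeWalks.

(** * The resolution by vertices, edges and short loops *)

Lemma finite_set_val (X Y : Type) (f : X -> Y) (A : set X) :
  injective f -> finite_set (f @` A) -> finite_set A.
Proof.
move=> fi fA; rewrite -(eq_finite_set (@inj_card_eq _ _ A f _)) //.
by move=> x y _ _; apply: fi.
Qed.

Section Resolution.
Variables (T : topologicalType) (mul : T -> T -> T) (inv : T -> T) (one : T).
Hypothesis tdlc : is_tdlc_group mul inv one.
Variables (V : choiceType) (act : T -> V -> V) (d : V -> V -> nat).
Hypothesis ca : ca_metric mul one act d.
Variable v0 : V.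

Let actP := ca_action ca.
Let gm := ca_metricP ca.
Let dI := ca_invariant ca.
Notation edge := (edge d).

Lemma edge_act_subproof g (e : edge) : d (act g (source e)) (act g (target e)) <= 1.
Proof. by rewrite dI edge_dist. Qed.
Definition edge_act (g : T) (e : edge) : edge :=
  exist _ (act g (source e), act g (target e)) (edge_act_subproof g e).

Lemma edge_actP : is_action mul one edge_act.
Proof.
split=> [e|g h e]; apply: val_inj => /=; last by rewrite !(actM actP).
by rewrite !(act1 actP); case: e => -[].
Qed.

Lemma edge_ext (e f : edge) : source e = source f -> target e = target f -> e = f.
Proof.
by move=> et eh; apply: val_inj; apply: injective_projections.
Qed.

Lemma edge_stab e : stab edge_act e = stab act (source e) `&` stab act (target e).
Proof.
apply/seteqP; split=> g /=; rewrite /stab /=; last by move=> [gt gh]; apply: edge_ext.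
by move=> ge; split; [rewrite -{2}ge | rewrite -{2}ge].
Qed.

Lemma stab_clopen v : closed (stab act v) /\ open (stab act v).
Proof.
by have [cS oS] := ca_stab ca v; split=> //; apply: compact_closed (tg_hausdorff tdlc) cS.
Qed.

Lemma edge_stab_clopen e : closed (stab edge_act e) /\ open (stab edge_act e).
Proof.
rewrite edge_stab; have [c1 o1] := stab_clopen (source e).
by have [c2 o2] := stab_clopen (target e); split; [apply: closedI | apply: openI].
Qed.

Lemma edge_stab_compact e : compact (stab edge_act e).
Proof.
rewrite edge_stab; apply: compact_closedI; first by have [] := ca_stab ca (source e).
by have [] := stab_clopen (target e).
Qed.

Lemma finite_edges u : finite_set [set e : edge | source e = u].
Proof.
apply: (@finite_set_val _ _ val _ val_inj).
apply: (@sub_finite_set _ _ ((fun v => (u, v)) @` [set v | d u v <= 1])).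
  move=> _ [e /= <- <-]; exists (target e); first exact: edge_dist.
  exact: esym (surjective_pairing _).
exact/finite_image/(ca_ball ca).
Qed.

Lemma vertices_proper : proper_fin_Gset mul one act.
Proof.
split=> //; split; first exact: (ca_stab ca).
exists [:: v0] => v; have [g <-] := ca_transitive ca v0 v.
by exists g, v0; rewrite inE.
Qed.

Lemma edges_proper : proper_fin_Gset mul one edge_act.
Proof.
split; first exact: edge_actP.
split; first by move=> e; split; [exact: edge_stab_compact | have [] := edge_stab_clopen e].
have /finite_seqP[s sE] := finite_edges v0; exists s => e.
have [g ge] := ca_transitive ca v0 (source e).
exists g, (edge_act (inv g) e); split; last by rewrite (actKV tdlc edge_actP).
have : [set e : edge | source e = v0] (edge_act (inv g) e).
  by rewrite /= /source /= -ge (actVK tdlc actP).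
by rewrite sE.
Qed.

Lemma ewalk_act g u (c : seq edge) v :
  ewalk (act g u) (map (edge_act g) c) (act g v) = ewalk u c v.
Proof.
elim: c u => [|e c IHc] u /=; first by rewrite (inj_eq (act_inj tdlc actP (g := g))).
by rewrite IHc (inj_eq (act_inj tdlc actP (g := g))).
Qed.

Lemma finite_walks n u :
  finite_set [set c : seq edge | size c = n /\ exists v, ewalk u c v].
Proof.
elim: n u => [|n IHn] u.
  by apply: sub_finite_set (finite_set1 [::]) => c /= [/size0nil].
apply: (@sub_finite_set _ _ (\bigcup_(e in [set e : edge | source e = u])
  (cons e @` [set c : seq edge | size c = n /\ exists v, ewalk (target e) c v]))).
  move=> [|e c] /= [] // [sc] [v /andP[/eqP te wc]].
  by exists e => //; exists c => //; split=> //; exists v.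
by apply: bigcup_finite => [|e _]; [apply: finite_edges | apply: finite_image].
Qed.

Variable N : nat.
Notation loop := (short_loop d N).

Lemma loop_act_subproof g (c : loop) :
  closed_walk (map (edge_act g) (val c)) && (size (map (edge_act g) (val c)) <= N).
Proof.
rewrite size_map; have /andP[cc ->] := valP c; rewrite andbT.
case: (val c) cc => // e c' cc.
by rewrite -[closed_walk _]/(ewalk (act g (source e)) (map (edge_act g) (e :: c')) (act g (source e)))
  ewalk_act.
Qed.
Definition loop_act g (c : loop) : loop :=
  exist _ (map (edge_act g) (val c)) (loop_act_subproof g c).

Lemma loop_actP : is_action mul one loop_act.
Proof.
split=> [c|g h c]; apply: val_inj => /=.
  by rewrite -[RHS]map_id; apply: eq_map => e; rewrite (act1 edge_actP).
by rewrite -map_comp; apply: eq_map => e; rewrite (actM edge_actP).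
Qed.

Lemma walk_stab_clopen (c : seq edge) :
  closed [set g | map (edge_act g) c = c] /\ open [set g | map (edge_act g) c = c].
Proof.
elim: c => [|e c [cc oc]].
  rewrite (_ : mkset _ = setT); first by split; [exact: closedT | exact: openT].
  by apply/seteqP; split.
have [ce oe] := edge_stab_clopen e.
have -> : [set g | map (edge_act g) (e :: c) = e :: c] =
    stab edge_act e `&` [set g | map (edge_act g) c = c].
  by apply/seteqP; split=> g /=; [move=> [] | move=> [] ge gc; congr cons].
by split; [apply: closedI | apply: openI].
Qed.

Lemma loops_proper : proper_fin_Gset mul one loop_act.
Proof.
split; first exact: loop_actP.
split.
  move=> c.
  have -> : stab loop_act c = [set g | map (edge_act g) (val c) = val c].
    by apply/seteqP; split=> g /=; [move/(congr1 val) | move=> e; apply: val_inj].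
  have [cl op] := walk_stab_clopen (val c); split=> //.
  (* A closed walk has a first edge, and the stabilizer of the walk is a closed part of the compact
     stabilizer of that edge. *)
  case: (val c) (valP c) cl => // e c' _ cl.
  rewrite (_ : mkset _ = stab edge_act e `&` [set g | map (edge_act g) (e :: c') = e :: c']).
    by apply: compact_closedI => //; apply: edge_stab_compact.
  by apply/seteqP; split=> g //= [] // ge gc; split=> //; rewrite ge gc.
(* Up to translation a loop starts at [v0], and only finitely many walks of bounded length do. *)
have fin : finite_set [set c : loop | exists v, ewalk v0 (val c) v].
  apply: (@finite_set_val _ _ val _ val_inj).
  apply: (@sub_finite_set _ _ (\bigcup_(n in `I_N.+1)
      [set c : seq edge | size c = n /\ exists v, ewalk v0 c v])).
    move=> _ [c /= wc <-]; exists (size (val c)) => //=.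
    by have /andP[_] := valP c; rewrite ltnS.
  by apply: bigcup_finite => [|n _]; [apply: finite_II | apply: finite_walks].
have /finite_seqP[s sE] := fin; exists s => c.
have [u wc] : exists u, ewalk u (val c) u.
  by case: (val c) (valP c) => // e c' /andP[wc _]; exists (source e).
have [g ge] := ca_transitive ca v0 u.
exists g, (loop_act (inv g) c); split; last by rewrite (actKV tdlc loop_actP).
have : [set c : loop | exists v, ewalk v0 (val c) v] (loop_act (inv g) c).
  exists v0; have := ewalk_act (inv g) u (val c) u.
  by rewrite -{1 2}ge (actVK tdlc actP) wc.
by rewrite sE.
Qed.

Lemma bd1_Gmap : Gmap edge_act act (@bd1 V d).
Proof.
split; first exact: fin_supp_bd1.
move=> g e v; rewrite /bd1 /delta /target /source /=.
by rewrite !(inj_eq (act_inj tdlc actP (g := g))).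
Qed.

Lemma bd2_Gmap : Gmap loop_act edge_act (@bd2 V d N).
Proof.
split; first exact: fin_supp_bd2.
move=> g c e; rewrite /bd2 /chain /= count_map; congr (_%:R)%R.
by apply: eq_count => e' /=; rewrite (inj_eq (act_inj tdlc edge_actP (g := g))).
Qed.

End Resolution.

(** [fills_cycle] yields both exactness at the edges and the inequality: every cycle has a filling
    of norm at most 10 times its own. *)
Lemma isoperimetric_of_four_point (T : topologicalType) (mul : T -> T -> T)
    (inv : T -> T) (one : T) (V : choiceType) (act : T -> V -> V) (d : V -> V -> nat)
    (v0 : V) (dlt : nat) :
  is_tdlc_group mul inv one -> ca_metric mul one act d -> four_point d dlt ->
  weak_linear_isoperimetric mul one.
Proof.
move=> tdlc ca fp; have gm := ca_metricP ca.
pose N := (2 * ((2 * dlt).+1 + (2 * dlt).+1))%N.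
have cyc := fills_cycle gm fp; rewrite -/N in cyc.
exists V, (edge d), (short_loop d N), act, (edge_act ca), (@loop_act _ _ _ _ tdlc _ _ _ ca N).
exists (fun=> 1%R), (@bd1 V d), (@bd2 V d N).
split; first exact: (vertices_proper ca v0).
split; first exact: (edges_proper tdlc ca v0).
split; first exact: (loops_proper tdlc ca v0).
split=> //; split; first exact: (bd1_Gmap tdlc).
split; first exact: bd2_Gmap.
split.
  move=> q; exists (fun v => q * delta v0 v)%R.
  split; first exact/fin_suppZ/fin_supp_delta.
  rewrite -/(pairing _ _) (pairingZl _ _ (@fin_supp_delta _ v0)).
  by rewrite pairing_delta mulr1.
split.
  move=> x fx; split; first exact: augmentation_exact.
  move=> [y [fy <-]]; rewrite -/(pairing _ _) (pairing_apply_map (@fin_supp_bd1 _ _)) //.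
  rewrite -[RHS](pairing0r y); apply: pairing_eq => e _.
  by rewrite pairing_bd1 subrr.
split.
  move=> x fx; split=> [/(cyc x fx)[y [fy ey _]]|[y [fy <-]]]; first by exists y.
  apply/funext => v; rewrite /apply_map.
  rewrite -/(pairing (apply_map (@bd2 V d N) y) (fun e => bd1 e v)).
  rewrite (pairing_apply_map (@fin_supp_bd2 _ _ _)) // -[RHS](pairing0r y).
  apply: pairing_eq => c _.
  have [u wc] : exists u, ewalk u (val c) u.
    by case: (val c) (valP c) => // e c' /andP[wc _]; exists (source e).
  have := congr1 (fun h => h v) (bd1_chain wc); rewrite /= mulN1r subrr.
  exact.
exists 10%R; split=> // x fx dx e e0; have [y [fy ey ly]] := cyc x fx dx.
by exists y; split=> //; split=> //; rewrite (le_trans ly) // lerDl ltW.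
Qed.

Lemma isoperimetric_of_hyperbolic (T : topologicalType) (mul : T -> T -> T) (inv : T -> T) (one : T) :
  is_tdlc_group mul inv one -> hyperbolic_group mul inv one ->
  compactly_presented mul inv one /\ weak_linear_isoperimetric mul one.
Proof.
move=> tdlc [_ [V [adj [act [cag hyp]]]]].
have [[v0 _] _] := cag.
have [d ca hypE] := cayley_abels_metric tdlc cag.
have [dlt fp] := proj1 hypE hyp.
split; first exact: (compactly_presented_of_four_point tdlc ca v0 fp).
(* The vertices receive a classical choice structure, so that they can index a permutation
   module. *)
exact: (@isoperimetric_of_four_point _ _ _ _ {classic V} act d v0 dlt tdlc ca fp).
Qed.

Theorem theorem1p4 (T : topologicalType) (mul : T -> T -> T) (inv : T -> T) (one : T) :
  is_tdlc_group mul inv one ->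
  compactly_generated mul inv one ->
  (hyperbolic_group mul inv one <->
   compactly_presented mul inv one /\ weak_linear_isoperimetric mul one).
Proof.
move=> tdlc cg; split; first exact: isoperimetric_of_hyperbolic.
by move=> [_]; apply: hyperbolic_of_isoperimetric.
Qed.
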